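(* Let $i\in\mathbb{N}_+$ and $\tilde w\in\mathbb{O}_{i,\tau}$. Write $x=v-v^{-1}$. (1) If $\ell(\mathbb{O}_{i,\tau})\leq\ell(\tilde w)\leq6i-5$, then $$f_{\tilde w,\mathbb{O}}=\begin{cases}x,&\mathbb{O}=\mathbb{O}_{\lambda,\tau},\ \lambda\in E_{\left(\lfloor\frac i2\rfloor+1+\frac{\ell(\tilde w)-\ell(\mathbb{O}_{i,\tau})}{2}\right)\alpha_1+i\alpha_2,\tau},\\ 1,&\mathbb{O}=\mathbb{O}_{i,\tau},\\ 0,&\text{otherwise.}\end{cases}$$ (2) If $\ell(\tilde w)=6i-3+4k$ with $k\in\mathbb{N}$, then $$f_{\tilde w,\mathbb{O}}=\begin{cases}kx^3,&\mathbb{O}=\mathbb{O}_{\lambda,\tau},\ \lambda\in\bigsqcup_{j=2}^{i-1}E_{(2j-1)\alpha_1+j\alpha_2,\tau},\\ kx^3+x,&\mathbb{O}=\mathbb{O}_{\lambda,\tau},\ \lambda\in E_{(2i-1)\alpha_1+i\alpha_2,\tau},\\ (k-j)x^3,&\mathbb{O}=\mathbb{O}_{\lambda,\tau},\ 1\leq j\leq k-1,\ \lambda\in E_{(2i-1+j)\alpha_1+(i+j)\alpha_2,\tau},\\ (k-1-j)x^3,&\mathbb{O}=\mathbb{O}_{\lambda,\tau},\ 2\leq j\leq k-2,\ \lambda\in E'_{(2i+j)\alpha_1+(i+j)\alpha_2,\tau},\\ (k-j)x^3+x,&\mathbb{O}=\mathbb{O}_{(2i-1+j)\alpha_1+(i+j)\alpha_2,\tau},\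 1\leq j\leq k,\\ kx^2,&\mathbb{O}=\mathbb{O}_{l,\tau},\ 2-2i\leq l\leq i-1,\\ kx^2+1,&\mathbb{O}=\mathbb{O}_{i,\tau},\\ (k-j)x^2,&\mathbb{O}=\mathbb{O}_{2-2i-j,\tau}\text{ or }\mathbb{O}_{i+j,\tau},\ 1\leq j\leq k-1,\\ kx,&\mathbb{O}=\mathbb{O}_{id,\tau},\\ x,&\mathbb{O}=\mathbb{O}_{(2i-1)\alpha_1+i\alpha_2,\tau},\\ 0,&\text{otherwise.}\end{cases}$$ (3) If $\ell(\tilde w)=6i-1+4k$ with $k\in\mathbb{N}$, then $$f_{\tilde w,\mathbb{O}}=\begin{cases}(k+1)x^3,&\mathbb{O}=\mathbb{O}_{\lambda,\tau},\ \lambda\in\bigsqcup_{j=2}^{i-1}E_{(2j-1)\alpha_1+j\alpha_2,\tau},\\ (k+1)x^3+x,&\mathbb{O}=\mathbb{O}_{\lambda,\tau},\ \lambda\in E_{(2i-1)\alpha_1+i\alpha_2,\tau},\\ (k+1-j)x^3,&\mathbb{O}=\mathbb{O}_{\lambda,\tau},\ 1\leq j\leq k,\ \lambda\in E_{(2i-1+j)\alpha_1+(i+j)\alpha_2,\tau},\\ (k-j)x^3,&\mathbb{O}=\mathbb{O}_{\lambda,\tau},\ 2\leq j\leq k-1,\ \lambda\in E'_{(2i+j)\alpha_1+(i+j)\alpha_2,\tau},\\ (k+1-j)x^3+x,&\mathbb{O}=\mathbb{O}_{(2i-1+j)\alpha_1+(i+j)\alpha_2,\tau},\ 1\leq j\leq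 k,\\ (k+1)x^2,&\mathbb{O}=\mathbb{O}_{l,\tau},\ 2-2i\leq l\leq i-1,\\ (k+1)x^2+1,&\mathbb{O}=\mathbb{O}_{i,\tau},\\ (k+1-j)x^2,&\mathbb{O}=\mathbb{O}_{2-2i-j,\tau}\text{ or }\mathbb{O}_{i+j,\tau},\ 1\leq j\leq k,\\ (k+1)x,&\mathbb{O}=\mathbb{O}_{id,\tau},\\ x,&\mathbb{O}=\mathbb{O}_{(2i-1)\alpha_1+i\alpha_2,\tau},\\ 0,&\text{otherwise.}\end{cases}$$
   Context: $W=\langle s_1,s_2\rangle$ is the finite Weyl group of type $A_2$; $\alpha_1,\alpha_2$ are the simple roots, identified with the simple coroots ($\langle\alpha_i,\alpha_i\rangle=2$, $\langle\alpha_1,\alpha_2\rangle=-1$); $Q=\mathbb{Z}\alpha_1\oplus\mathbb{Z}\alpha_2$; $P$ is the coweight lattice, $P_+$ its dominant elements; $\widetilde W=P\rtimes W$ with translations $t^\lambda$. $W_a=Q\rtimes W$ is the Coxeter group generated by $s_0=t^{\alpha_1+\alpha_2}s_1s_2s_1$, $s_1$, $s_2$; $\widetilde W=W_a\rtimes\langle\tau\rangle$ with $\tau^3=1$, $\tau s_0\tau^{-1}=s_1$, $\tau s_1\tau^{-1}=s_2$, $\tau s_2\tau^{-1}=s_0$, i.e. $\tau=t^{(2\alpha_1+\alpha_2)/3}s_1s_2$; $\ell(w\tau^j)=\ell(w)$ for $w\in W_a$. $\mathbb{N}$ contains $0$; $\mathbb{N}_+=\mathbb{N}\setminus\{0\}$.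 Class polynomials: $\widetilde H$ is the algebra over $\mathbb{Z}[v,v^{-1}]$ with basis $T_{\tilde w}$ ($\tilde w\in\widetilde W$), $T_{\tilde x}T_{\tilde y}=T_{\tilde x\tilde y}$ if $\ell(\tilde x)+\ell(\tilde y)=\ell(\tilde x\tilde y)$, and $(T_s-v)(T_s+v^{-1})=0$ for $s\in\{s_0,s_1,s_2\}$. $[\widetilde H,\widetilde H]$ is the submodule spanned by commutators. For a conjugacy class $\mathbb{O}$ of $\widetilde W$, $\ell(\mathbb{O})$ is its minimal length and $T_{\mathbb{O}}$ is the image in $\widetilde H/[\widetilde H,\widetilde H]$ of $T_{w}$ for any minimal length $w\in\mathbb{O}$; by He–Nie this is well defined and the $T_{\mathbb{O}}$ form a basis. The class polynomials $f_{\tilde w,\mathbb{O}}$ are the unique coefficients with $T_{\tilde w}\equiv\sum_{\mathbb{O}}f_{\tilde w,\mathbb{O}}T_{\mathbb{O}}\bmod[\widetilde H,\widetilde H]$. Conjugacy classes of $\widetilde W$ in $W_a\tau$: $\mathbb{O}_{id,\tau}=\{t^{m\alpha_1+n\alpha_2}\tau,\ t^{m\alpha_1+n\alpha_2}s_1s_2\tau\mid m,n\in\mathbb{Z}\}$; for $\lambda\in P_+\cap Q$ not of the form $2m\alpha_1+m\alpha_2$ ($m\geq0$), $\mathbb{O}_{\lambda,\tau}$ is the class of $t^\lambda s_2s_1\tau$; for $i\in\mathbb{Z}$, $\mathbb{O}_{i,\tau}=\{t^{k\alpha_1+i\alpha_2}s_1s_2s_1\tau,\ t^{(k+i-1)\alpha_1+k\alpha_2}s_2\tau,\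 t^{(1-i)\alpha_1+k\alpha_2}s_1\tau\mid k\in\mathbb{Z}\}$. $E_{m\alpha_1+n\alpha_2,\tau}=\{k\alpha_1+n\alpha_2\mid\lfloor\frac n2\rfloor+1\leq k\leq m-1\}$ and $E'_{m\alpha_1+n\alpha_2,\tau}=\{m\alpha_1+k\alpha_2\mid\lfloor\frac{m+1}2\rfloor+1\leq k\leq n\}$. *)

(* Defs.v *)
From HB Require Import structures.
From mathcomp Require Import all_boot all_order all_algebra all_fingroup.
From mathcomp Require Import fraction finmap boolp classical_sets.
From mathcomp Require Import ring.

Set Implicit Arguments.
Unset Strict Implicit.
Unset Printing Implicit Defensive.

Import GRing.Theory.

Local Open Scope ring_scope.

(* laurent is Z[v, v^-1], realised inside the field of fractions of Z[v];
   lv, lvi and lx are v, v^-1 and v - v^-1. *)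
Definition is_laurent : {pred {fraction {poly int}}} := fun z =>
  `[< exists (p : {poly int}) (n : nat),
        z = FracField.tofrac p / FracField.tofrac 'X ^+ n >].

Fact div_exp_sub (F : fieldType) (p q x : F) (n m : nat) : x != 0 ->
  p / x ^+ n - q / x ^+ m = (p * x ^+ m - q * x ^+ n) / x ^+ (n + m).
Proof. by move=> x0; rewrite exprD; field; rewrite !expf_neq0. Qed.

Fact div_exp_mul (F : fieldType) (p q x : F) (n m : nat) :
  p / x ^+ n * (q / x ^+ m) = p * q / x ^+ (n + m).
Proof. by rewrite mulf_div exprD. Qed.

Fact is_laurent_subring : subring_closed is_laurent.
Proof.
have X0 : FracField.tofrac 'X != 0 :> {fraction {poly int}}.
  by rewrite tofrac_eq0 polyX_eq0.
split=> [|z1 z2 /asboolP[p [n ->]] /asboolP[q [m ->]]|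
          z1 z2 /asboolP[p [n ->]] /asboolP[q [m ->]]]; apply/asboolP.
- by exists 1, 0%N; rewrite tofrac1 expr0 divr1.
- exists (p * 'X^m - q * 'X^n), (n + m)%N.
  by rewrite (div_exp_sub _ _ _ _ X0) tofracB !tofracM !tofracXn.
- by exists (p * q), (n + m)%N; rewrite div_exp_mul tofracM.
Qed.

HB.instance Definition _ :=
  GRing.isSubringClosed.Build {fraction {poly int}} is_laurent
    is_laurent_subring.

Record laurent :=
  Laurent { laurent_val :> {fraction {poly int}};
            _ : laurent_val \in is_laurent }.

HB.instance Definition _ := [isSub for laurent_val].
HB.instance Definition _ := [Choice of laurent by <:].
HB.instance Definition _ := [SubChoice_isSubComNzRing of laurent by <:].

Fact is_laurentX : FracField.tofrac 'X \in is_laurent.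
Proof. by apply/asboolP; exists 'X, 0%N; rewrite expr0 divr1. Qed.

Fact is_laurentXV : (FracField.tofrac 'X)^-1 \in is_laurent.
Proof. by apply/asboolP; exists 1, 1%N; rewrite tofrac1 expr1 div1r. Qed.

Definition lv : laurent := Laurent is_laurentX.
Definition lvi : laurent := Laurent is_laurentXV.

Lemma lvK : lv * lvi = 1.
Proof. by apply: val_inj; rewrite /= divff // tofrac_eq0 polyX_eq0. Qed.

Definition lx : laurent := lv - lvi.

(* A coweight lambda is recorded by (<lambda, alpha_1>, <lambda, alpha_2>),
   i.e. by its coordinates in the basis of fundamental coweights. *)

Definition coweight : Type := (int * int)%type.
HB.instance Definition _ := GRing.Zmodule.on coweight.

Definition alpha1 : coweight := (2, -1).
Definition alpha2 : coweight := (-1, 2).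
Definition omega1 : coweight := (1, 0).
Definition rt (m n : int) : coweight := alpha1 *~ m + alpha2 *~ n.

Lemma omega1E : omega1 *+ 3 = alpha1 *+ 2 + alpha2.
Proof. by []. Qed.

Lemma coweightMz (a b k : int) : ((a, b) : coweight) *~ k = (a * k, b * k).
Proof.
have Mn n : ((a, b) : coweight) *+ n = (a * n%:Z, b * n%:Z).
  elim: n => [|n IH]; first by rewrite mulr0n !mulr0.
  by rewrite mulrS IH intS !mulrDr !mulr1.
case: k => n; first exact: Mn.
by rewrite NegzE mulrNz -pmulrn Mn !mulrN.
Qed.

Lemma rtE m n : rt m n = (2 * m - n, 2 * n - m).
Proof.
rewrite /rt /alpha1 /alpha2 !coweightMz.
have -> (a b c d : int) : ((a, b) : coweight) + (c, d) = (a + c, b + d) by [].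
by congr pair; ring.
Qed.

(* W is the symmetric group on {0, 1, 2}. The coweight lattice is
   Z^3 / Z(1, 1, 1), on which w acts by (w . x)_i = x_(w i); since
   (w1 * w2) i = w2 (w1 i) in mathcomp, this is a left action. *)

Definition coord (l : coweight) (i : 'I_3) : int :=
  match nat_of_ord i with 0 => l.1 + l.2 | 1 => l.2 | _ => 0 end.

Definition i0 : 'I_3 := Ordinal (isT : 0 < 3)%N.
Definition i1 : 'I_3 := Ordinal (isT : 1 < 3)%N.
Definition i2 : 'I_3 := Ordinal (isT : 2 < 3)%N.

Lemma ord3P (P : 'I_3 -> Prop) : P i0 -> P i1 -> P i2 -> forall i, P i.
Proof.
move=> P0 P1 P2 [[|[|[|//]]] lti].
- by rewrite (_ : Ordinal lti = i0) //; apply: val_inj.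
- by rewrite (_ : Ordinal lti = i1) //; apply: val_inj.
- by rewrite (_ : Ordinal lti = i2) //; apply: val_inj.
Qed.

Definition wact (w : 'S_3) (l : coweight) : coweight :=
  (coord l (w i0) - coord l (w i1), coord l (w i1) - coord l (w i2)).

Definition p1 : 'S_3 := tperm i0 i1.
Definition p2 : 'S_3 := tperm i1 i2.

Lemma coord_wact w l : exists c, forall i, coord (wact w l) i = coord l (w i) - c.
Proof. by exists (coord l (w i2)); apply: ord3P; rewrite /coord/wact /=; ring. Qed.

Lemma wactD w l m : wact w (l + m) = wact w l + wact w m.
Proof.
have cD i : coord (l + m) i = coord l i + coord m i.
  by move: i; apply: ord3P; rewrite /coord /=; ring.
by rewrite /wact !cD; congr pair => /=; ring.
Qed.

Lemma wact1 l : wact 1%g l = l.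
Proof. by case: l => a b; rewrite /wact !perm1 /coord /=; congr pair; ring. Qed.

Lemma wactM w1 w2 l : wact (w1 * w2)%g l = wact w1 (wact w2 l).
Proof.
have [c Hc] := coord_wact w2 l.
by rewrite {2}/wact !Hc /wact !permM; congr pair; ring.
Qed.

Lemma wact0 w : wact w 0 = 0.
Proof. by apply: (addrI (wact w 0)); rewrite -wactD !addr0. Qed.

Lemma wactN w l : wact w (- l) = - wact w l.
Proof. by apply: (addrI (wact w l)); rewrite -wactD !subrr wact0. Qed.

(* The extended affine Weyl group: EW l w is t^l w. *)

Record extW := EW { tpart : coweight; wpart : 'S_3 }.

Definition extW_pair (x : extW) := (tpart x, wpart x).
Definition pair_extW (p : coweight * 'S_3) := EW p.1 p.2.
Fact extW_pairK : cancel extW_pair pair_extW.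
Proof. by case. Qed.

HB.instance Definition _ := Choice.copy extW (can_type extW_pairK).

Definition extW_one := EW 0 1%g.
Definition extW_mul x y :=
  EW (tpart x + wact (wpart x) (tpart y)) (wpart x * wpart y)%g.
Definition extW_inv x := EW (wact (wpart x)^-1%g (- tpart x)) (wpart x)^-1%g.

Fact extW_mulA : associative extW_mul.
Proof.
by move=> [a u] [b w] [c z]; rewrite /extW_mul /= wactD wactM addrA mulgA.
Qed.
Fact extW_mul1 : left_id extW_one extW_mul.
Proof. by case=> a u; rewrite /extW_mul /= wact1 add0r mul1g. Qed.
Fact extW_mulr1 : right_id extW_one extW_mul.
Proof. by case=> a u; rewrite /extW_mul /= wact0 addr0 mulg1. Qed.
Fact extW_mulV : left_inverse extW_one extW_inv extW_mul.
Proof.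
by case=> a u; rewrite /extW_mul /extW_inv /= -wactD addrC subrr wact0 mulVg.
Qed.
Fact extW_mulrV : right_inverse extW_one extW_inv extW_mul.
Proof.
by case=> a u; rewrite /extW_mul /extW_inv /= -wactM mulgV wact1 subrr.
Qed.

HB.instance Definition _ := isGroup.Build extW
  extW_mulA extW_mul1 extW_mulr1 extW_mulV extW_mulrV.

Definition trans (l : coweight) : extW := EW l 1%g.
Definition s1 : extW := EW 0 p1.
Definition s2 : extW := EW 0 p2.
Definition s0 : extW := (trans (alpha1 + alpha2) * s1 * s2 * s1)%g.
Definition tau : extW := (trans omega1 * s1 * s2)%g.

Lemma EWM l u m w : (EW l u * EW m w = EW (l + wact u m) (u * w))%g.
Proof. by []. Qed.

Lemma p1p2p1 : (p1 * p2 * p1 = p2 * p1 * p2)%g.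
Proof. by apply/permP; apply: ord3P; rewrite !permE /= !permE /= !permE. Qed.

Lemma perm3E (u w : 'S_3) :
  u i0 = w i0 -> u i1 = w i1 -> u i2 = w i2 -> u = w.
Proof. by move=> *; apply/permP; apply: ord3P. Qed.

Lemma S3_ind (P : 'S_3 -> Prop) : P 1%g ->
  (forall u, P u -> P (p1 * u)%g) -> (forall u, P u -> P (p2 * u)%g) ->
  forall u, P u.
Proof.
move=> H1 H2 H3 u.
suff: [\/ u = 1%g, u = (p1 * 1)%g, u = (p2 * 1)%g | [\/ u = (p1 * (p2 * 1))%g,
  u = (p2 * (p1 * 1))%g | u = (p1 * (p2 * (p1 * 1)))%g]].
  by case=> [->|->|->|[->|->|->]]; auto.
have n01 : u i0 != u i1 by rewrite (inj_eq perm_inj).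
have n02 : u i0 != u i2 by rewrite (inj_eq perm_inj).
have n12 : u i1 != u i2 by rewrite (inj_eq perm_inj).
have E3 (w : 'S_3) : u i0 = w i0 -> u i1 = w i1 -> u i2 = w i2 -> u = w.
  by move=> *; apply/permP; apply: ord3P.
have [[a Ea] [b Eb] [c Ec]] : [/\ exists a, u i0 = a, exists b, u i1 = b
    & exists c, u i2 = c] by split; eexists.
rewrite Ea Eb Ec in E3 n01 n02 n12.
move: a b c E3 n01 n02 n12 {Ea Eb Ec}.
do 3![apply: ord3P => //] => E3 _ _ _.
- by constructor 1; apply: E3; rewrite !permE.
- by constructor 3; apply: E3; do 3!rewrite ?permE /=.
- by constructor 2; apply: E3; do 3!rewrite ?permE /=.
- by constructor 4; constructor 2; apply: E3; do 4!rewrite ?permE /=.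
- by constructor 4; constructor 1; apply: E3; do 4!rewrite ?permE /=.
- by constructor 4; constructor 3; apply: E3; do 5!rewrite ?permE /=.
Qed.

Lemma p1K : (p1 * p1 = 1)%g. Proof. exact: tperm2. Qed.
Lemma p2K : (p2 * p2 = 1)%g. Proof. exact: tperm2. Qed.

Lemma wact_p1 l : wact p1 l = (- l.1, l.1 + l.2).
Proof. by rewrite /wact !permE /coord /=; congr pair; ring. Qed.
Lemma wact_p2 l : wact p2 l = (l.1 + l.2, - l.2).
Proof. by rewrite /wact !permE /coord /=; congr pair; ring. Qed.

Lemma tauE : tau = EW (1, 0) (p1 * p2).
Proof. by rewrite /tau !EWM !wact0 !addr0 mul1g. Qed.

Lemma s0E : s0 = EW (1, 1) (p1 * p2 * p1).
Proof. by rewrite /s0 !EWM !wact0 !addr0 mul1g. Qed.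

Lemma extW_eq (x y : extW) :
  (tpart x).1 = (tpart y).1 -> (tpart x).2 = (tpart y).2 ->
  wpart x i0 = wpart y i0 -> wpart x i1 = wpart y i1 ->
  wpart x i2 = wpart y i2 -> x = y.
Proof.
case: x y => [[a b] u] [[c d] w] /= -> -> e0 e1 e2; congr EW.
exact: perm3E.
Qed.

Local Ltac ewcalc :=
  rewrite ?(tauE, s0E) ?EWM ?wactM ?(wact1, wact_p1, wact_p2) /=;
  apply: extW_eq; rewrite /= ?permE /= ?permE /= ?permE /= ?permE /= ?permE /=
    ?permE /= ?permE /=; try ring; try by [].

Lemma tau3 : (tau ^+ 3 = 1)%g.
Proof. by rewrite !expgS expg0 mulg1; ewcalc. Qed.

Lemma tau_s0 : (tau * s0 = s1 * tau)%g.
Proof. by ewcalc. Qed.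

Lemma tau_s1 : (tau * s1 = s2 * tau)%g.
Proof. by ewcalc. Qed.

Lemma tau_s2 : (tau * s2 = s0 * tau)%g.
Proof. by ewcalc. Qed.

Lemma s1K : (s1 * s1 = 1)%g.
Proof. by rewrite EWM wact0 addr0 p1K. Qed.
Lemma s2K : (s2 * s2 = 1)%g.
Proof. by rewrite EWM wact0 addr0 p2K. Qed.

Lemma extW_ind (P : extW -> Prop) : P 1%g ->
  (forall x, P x -> P (s1 * x)%g) -> (forall x, P x -> P (s2 * x)%g) ->
  (forall x, P x -> P (tau * x)%g) -> forall x, P x.
Proof.
move=> P1 Ps1 Ps2 Ptau.
pose C y := forall x, P x -> P (y * x)%g.
have CM y z : C y -> C z -> C (y * z)%g.
  by move=> Cy Cz x Px; rewrite -mulgA; apply/Cy/Cz.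
have C1 : C 1%g by move=> x; rewrite mul1g.
have CX y n : C y -> C (y ^+ n)%g.
  by move=> Cy; elim: n => [|n IH]; [rewrite expg0|rewrite expgS; apply: CM].
suff H x : C x by move=> x; rewrite -[x]mulg1; apply: H.
have Ca : C (EW (1, 0) 1%g).
  have -> : EW (1, 0) 1%g = (tau * s2 * s1)%g.
    by ewcalc.
  by do 2!apply: (CM) => //.
have Ca' : C (EW (-1, 0) 1%g).
  have -> : EW (-1, 0) 1%g = (s1 * s2 * tau * tau)%g.
    by ewcalc.
  by do 3!apply: (CM) => //.
have Cb' : C (EW (0, -1) 1%g).
  have -> : EW (0, -1) 1%g = (s2 * s1 * EW (1%R, 0%R) 1 * s1 * s2)%g.
    by ewcalc.
  by do 4!apply: (CM) => //.
have Cb : C (EW (0, 1) 1%g).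
  have -> : EW (0, 1) 1%g = (s2 * s1 * EW (-1, 0%R) 1 * s1 * s2)%g.
    by ewcalc.
  by do 4!apply: (CM) => //.
have Cw u : C (EW 0 u).
  elim/S3_ind: u => [//|u Cu|u Cu].
  - have -> : EW 0 (p1 * u)%g = (s1 * EW 0 u)%g by rewrite EWM wact0 addr0.
    by apply: CM.
  - have -> : EW 0 (p2 * u)%g = (s2 * EW 0 u)%g by rewrite EWM wact0 addr0.
    by apply: CM.
have EX l n : (EW l 1 ^+ n)%g = EW (l *+ n) 1%g.
  elim: n => [|n IH]; first by rewrite expg0 mulr0n.
  by rewrite expgS IH EWM wact1 mulg1 mulrS.
have ET a b u : EW (a, b) u = (EW (a, 0%R) 1 * EW (0%R, b) 1 * EW 0 u)%g.
  rewrite !EWM !mul1g !wact1 addr0; congr EW.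
  by apply/eqP; rewrite xpair_eqE /= addr0 add0r !eqxx.
have ME (l m : coweight) n : m = l *+ n -> C (EW l 1%g) -> C (EW m 1%g).
  by move=> -> Cl; rewrite -EX; apply: CX.
have nE (a : int) n : a *+ n = a * n%:Z by rewrite -mulr_natr natz.
case: x => [[a b] u]; rewrite ET; apply: (CM) => //; apply: (CM).
  case: a => n.
    by apply: (ME _ _ n) Ca; rewrite pairMnE /= !nE mul1r mul0r.
  by apply: (ME _ _ n.+1) Ca'; rewrite pairMnE /= !nE NegzE mulN1r mul0r.
case: b => n.
  by apply: (ME _ _ n) Cb; rewrite pairMnE /= !nE mul1r mul0r.
by apply: (ME _ _ n.+1) Cb'; rewrite pairMnE /= !nE NegzE mulN1r mul0r.
Qed.

Definition simple (i : 'I_3) : extW :=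
  match nat_of_ord i with 0 => s0 | 1 => s1 | _ => s2 end.

(* x = u tau^j, where u is a product of n simple reflections. *)
Definition has_word (x : extW) (n : nat) : bool :=
  [exists a : n.-tuple 'I_3, [exists j : 'I_3,
     x == ((\prod_(i <- a) simple i) * tau ^+ j)%g]].

Lemma has_wordP x :
  (exists (a : seq 'I_3) (j : nat),
     x = ((\prod_(i <- a) simple i) * tau ^+ j)%g) -> exists n, has_word x n.
Proof.
move=> [a [j ->]]; exists (size a).
apply/existsP; exists (in_tuple a).
apply/existsP; exists (Ordinal (ltn_pmod j (isT : 0 < 3)%N)) => /=.
by rewrite {1}(divn_eq j 3) mulnC expgnDr expgnA tau3 expg1n mul1g.
Qed.

Lemma has_word_ex x : exists n, has_word x n.
Proof.
apply: has_wordP; elim/extW_ind: x => [|x [a [j ->]]|x [a [j ->]]|x [a [j ->]]].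
- by exists [::], 0%N; rewrite big_nil expg0 mulg1.
- by exists (i1 :: a), j; rewrite big_cons mulgA.
- by exists (i2 :: a), j; rewrite big_cons mulgA.
suff [b Eb] : exists b : seq 'I_3, (tau * (\prod_(i <- a) simple i) =
    (\prod_(i <- b) simple i) * tau)%g.
  by exists b, j.+1; rewrite mulgA Eb -mulgA -expgS.
elim: a => [|i a [b Eb]]; first by exists [::]; rewrite !big_nil mulg1 mul1g.
have [k Ek] : exists k, (tau * simple i = simple k * tau)%g.
  move: i; apply: ord3P; [exists i1|exists i2|exists i0].
  - exact: tau_s0.
  - exact: tau_s1.
  - exact: tau_s2.
by exists (k :: b); rewrite !big_cons mulgA Ek -(mulgA (simple k) tau) Eb mulgA.
Qed.

Definition length (x : extW) : nat := ex_minn (has_word_ex x).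

Definition conj_set (x : extW) : set extW := [set (x ^ g)%g | g in setT].

Record conjclass := ConjClass {
  cc_set : set extW;
  _ : `[< exists x, cc_set = conj_set x >] }.

HB.instance Definition _ := [isSub for cc_set].
HB.instance Definition _ := [Choice of conjclass by <:].

Lemma conj_setP x : `[< exists y, conj_set x = conj_set y >].
Proof. by apply/asboolP; exists x. Qed.

Definition class_of (x : extW) : conjclass := ConjClass (conj_setP x).

Lemma conjclass_neq0 (O : conjclass) : exists x, cc_set O x.
Proof. by case: O => A /= /asboolP[x ->]; exists x, 1%g; rewrite ?conjg1. Qed.

Lemma conjclass_length_ex (O : conjclass) :
  exists n, `[< exists2 x, cc_set O x & length x = n >].
Proof.
by have [x Ox] := conjclass_neq0 O; exists (length x); apply/asboolP; exists x.
Qed.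

Definition class_length (O : conjclass) : nat :=
  ex_minn (conjclass_length_ex O).

Definition set_id : set extW := [set x | exists m n : int,
  x = (trans (rt m n) * tau)%g \/ x = (trans (rt m n) * s1 * s2 * tau)%g].

Definition set_i (i : int) : set extW := [set x | exists k : int,
  [\/ x = (trans (rt k i) * s1 * s2 * s1 * tau)%g,
      x = (trans (rt (k + i - 1) k) * s2 * tau)%g
    | x = (trans (rt (1 - i) k) * s1 * tau)%g]].

Lemma conj_setE (A : set extW) x0 : A x0 ->
  (forall x, A x -> A (x ^ s1)%g) -> (forall x, A x -> A (x ^ s2)%g) ->
  (forall x, A x -> A (x ^ tau)%g) ->
  (forall x, A x -> exists g, x = (x0 ^ g)%g) -> A = conj_set x0.
Proof.
move=> A0 A1 A2 At AC; apply/seteqP; split=> [x /AC[g ->]|_ [g _ <-]].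
  by exists g.
elim/extW_ind: g x0 A0 {AC} => [|g IH|g IH|g IH] x0 A0.
- by rewrite conjg1.
- by rewrite conjgM; apply/IH/A1.
- by rewrite conjgM; apply/IH/A2.
- by rewrite conjgM; apply/IH/At.
Qed.

Lemma set_iE i k :
  [/\ (trans (rt k i) * s1 * s2 * s1 * tau = EW (2 * k - i, 2 * i - k - 1) p1)%g,
      (trans (rt (k + i - 1) k) * s2 * tau
         = EW (k + 2 * i - 1, k - i + 1) (p1 * p2 * p1))%g
    & (trans (rt (1 - i) k) * s1 * tau = EW (1 - 2 * i - k, 2 * k + i) p2)%g].
Proof. by rewrite /trans !rtE; split; ewcalc. Qed.

Lemma set_idE m n :
  (trans (rt m n) * tau = EW (2 * m - n + 1, 2 * n - m) (p1 * p2))%g /\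
  (trans (rt m n) * s1 * s2 * tau = EW (2 * m - n - 1, 2 * n - m + 1) (p2 * p1))%g.
Proof. by rewrite /trans !rtE; split; ewcalc. Qed.

Lemma conjgV1 (x y z : extW) : (y * z = 1 -> x ^ y = z * x * y)%g.
Proof. by move=> H; rewrite conjgE -(mulg1_eq H) mulgA. Qed.

Lemma tauV : (tau * EW (0, 1)%R (p2 * p1) = 1)%g.
Proof. by ewcalc. Qed.

Lemma transV a b : (EW (a, b) 1 * EW (- a, - b)%R 1 = 1)%g.
Proof. by ewcalc. Qed.

Lemma set_i_class i : `[< exists x, set_i i = conj_set x >].
Proof.
have H1 (k : int) : set_i i (EW (2 * k - i, 2 * i - k - 1) p1).
  by exists k; constructor 1; have [] := set_iE i k.
have H2 (k : int) : set_i i (EW (k + 2 * i - 1, k - i + 1) (p1 * p2 * p1)).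
  by exists k; constructor 2; have [] := set_iE i k.
have H3 (k : int) : set_i i (EW (1 - 2 * i - k, 2 * k + i) p2).
  by exists k; constructor 3; have [] := set_iE i k.
have H x : set_i i x -> exists k : int, [\/ x = EW (2 * k - i, 2 * i - k - 1) p1,
    x = EW (k + 2 * i - 1, k - i + 1) (p1 * p2 * p1)
    | x = EW (1 - 2 * i - k, 2 * k + i) p2].
  by case=> k; have [-> -> ->] := set_iE i k; exists k.
have eqH x y : set_i i y -> x = y -> set_i i x by move=> ? ->.
apply/asboolP; exists (EW (2 * 0 - i, 2 * i - 0 - 1) p1).
apply: conj_setE => // x /H[k Hx].
- rewrite (conjgV1 _ s1K); case: Hx => ->.
  + by apply: (eqH _ _ (H1 (i - k))); ewcalc.
  + by apply: (eqH _ _ (H3 k)); ewcalc.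
  + by apply: (eqH _ _ (H2 k)); ewcalc.
- rewrite (conjgV1 _ s2K); case: Hx => ->.
  + by apply: (eqH _ _ (H2 (k - i))); ewcalc.
  + by apply: (eqH _ _ (H1 (k + i))); ewcalc.
  + by apply: (eqH _ _ (H3 (- i - k))); ewcalc.
- rewrite (conjgV1 _ tauV); case: Hx => ->.
  + by apply: (eqH _ _ (H2 (1 - k))); ewcalc.
  + by apply: (eqH _ _ (H3 (1 - i - k))); ewcalc.
  + by apply: (eqH _ _ (H1 (k + i))); ewcalc.
- case: Hx => ->; [exists (EW (- k, 0%R) 1%g)
    | exists (EW (k - 1, 0)%R 1 * tau)%g
    | exists (EW (- k - i, 0)%R 1 * tau * tau)%g].
  + by rewrite (conjgV1 _ (transV _ _)); ewcalc.
  + by rewrite (conjgM _ _ tau) (conjgV1 _ tauV) (conjgV1 _ (transV _ _)); ewcalc.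
  + rewrite (conjgM _ (_ * tau)%g) (conjgM _ _ tau) !(conjgV1 _ tauV).
    by rewrite (conjgV1 _ (transV _ _)); ewcalc.
Qed.

Lemma set_id_class : `[< exists x, set_id = conj_set x >].
Proof.
have H1 m n : set_id (EW (2 * m - n + 1, 2 * n - m) (p1 * p2)).
  by exists m, n; left; have [] := set_idE m n.
have H2 m n : set_id (EW (2 * m - n - 1, 2 * n - m + 1) (p2 * p1)).
  by exists m, n; right; have [] := set_idE m n.
have H x : set_id x -> exists m n, x = EW (2 * m - n + 1, 2 * n - m) (p1 * p2)
    \/ x = EW (2 * m - n - 1, 2 * n - m + 1) (p2 * p1).
  by case=> m [n]; have [-> ->] := set_idE m n; exists m, n.
have eqH x y : set_id y -> x = y -> set_id x by move=> ? ->.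
apply/asboolP; exists (EW (2 * 0 - 0 + 1, 2 * 0 - 0) (p1 * p2)).
apply: conj_setE => // x /H[m [n Hx]].
- rewrite (conjgV1 _ s1K); case: Hx => ->.
  + by apply: (eqH _ _ (H2 (n - m) n)); ewcalc.
  + by apply: (eqH _ _ (H1 (n - m) n)); ewcalc.
- rewrite (conjgV1 _ s2K); case: Hx => ->.
  + by apply: (eqH _ _ (H2 (m + 1) (m - n))); ewcalc.
  + by apply: (eqH _ _ (H1 (m - 1) (m - n - 1))); ewcalc.
- rewrite (conjgV1 _ tauV); case: Hx => ->.
  + by apply: (eqH _ _ (H1 (n - m) (- m))); ewcalc.
  + by apply: (eqH _ _ (H2 (n - m + 1) (1 - m))); ewcalc.
- case: Hx => ->; [exists (EW (n - m, - n) 1%g)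
    | exists (EW (m, - n)%R 1 * s1)%g].
  + by rewrite (conjgV1 _ (transV _ _)); ewcalc.
  + by rewrite (conjgM _ _ s1) (conjgV1 _ s1K) (conjgV1 _ (transV _ _)); ewcalc.
Qed.

Definition class_id : conjclass := ConjClass set_id_class.
Definition class_i (i : int) : conjclass := ConjClass (set_i_class i).
(* Every l is allowed here, although the classes of this form are indexed by
   the dominant l in the coroot lattice other than 2 m alpha1 + m alpha2. *)
Definition class_lam (l : coweight) : conjclass :=
  class_of (trans l * s2 * s1 * tau)%g.

(* E_{m alpha1 + n alpha2, tau} and E'_{m alpha1 + n alpha2, tau}; both (_ %/ 2)%Z
   are floors. *)
Definition setE (m n : int) : set coweight := [set l | exists k : int,
  (n %/ 2)%Z + 1 <= k <= m - 1 /\ l = rt k n].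

Definition setE' (m n : int) : set coweight := [set l | exists k : int,
  ((m + 1) %/ 2)%Z + 1 <= k <= n /\ l = rt m k].

Record is_hecke_algebra (H : algType laurent) (T : extW -> H) : Prop := {
  hecke_basis : forall h : H, exists! c : {fsfun extW -> laurent with 0},
    h = \sum_(x <- finsupp c) c x *: T x;
  hecke_mul : forall x y : extW,
    (length x + length y)%N = length (x * y)%g -> T x * T y = T (x * y)%g;
  hecke_quad : forall i : 'I_3,
    (T (simple i) - lv%:A) * (T (simple i) + lvi%:A) = 0 }.

Definition commutator_span (H : algType laurent) (h : H) : Prop :=
  exists s : seq (laurent * H * H),
    h = \sum_(c <- s) c.1.1 *: (c.1.2 * c.2 - c.2 * c.1.2).

Definition is_min_length (O : conjclass) (x : extW) : Prop :=
  cc_set O x /\ length x = class_length O.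

(* T_x = sum_O f_O T_O modulo commutators, where T_O is the image of T_(r O)
   for an arbitrary choice r O of minimal length elements. *)
Definition class_expansion (H : algType laurent) (T : extW -> H) (x : extW)
    (f : {fsfun conjclass -> laurent with 0}) : Prop :=
  forall r : conjclass -> extW, (forall O, is_min_length O (r O)) ->
    commutator_span (T x - \sum_(O <- finsupp f) f O *: T (r O)).

Definition is_class_poly (H : algType laurent) (T : extW -> H) (x : extW)
    (f : {fsfun conjclass -> laurent with 0}) : Prop :=
  unique (class_expansion T x) f.

(* f is given by the table R and vanishes at the classes R does not mention. *)
Definition given_by (f : conjclass -> laurent)
    (R : conjclass -> laurent -> Prop) : Prop :=
  (forall O y, R O y -> f O = y) /\ (forall O, (forall y, ~ R O y) -> f O = 0).

(* Lengths in a conjugacy class have the same parity, so the halving below is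
   exact for len >= class_length (class_i i) attained in class_i i. *)
Inductive table1 (i len : nat) : conjclass -> laurent -> Prop :=
| Table1E l of
    setE ((i%:Z %/ 2)%Z + 1 + ((len - class_length (class_i i%:Z)) %/ 2)%N%:Z)
      i%:Z l :
    table1 i len (class_lam l) lx
| Table1i : table1 i len (class_i i%:Z) 1.

Inductive table2 (i k : nat) : conjclass -> laurent -> Prop :=
| Table2E (j : nat) l of (2 <= j <= i - 1)%N
    & setE (2 * j%:Z - 1) j%:Z l :
    table2 i k (class_lam l) (k%:R * lx ^+ 3)
| Table2Ei l of setE (2 * i%:Z - 1) i%:Z l :
    table2 i k (class_lam l) (k%:R * lx ^+ 3 + lx)
| Table2Eij (j : nat) l of (1 <= j <= k - 1)%N
    & setE (2 * i%:Z - 1 + j%:Z) (i%:Z + j%:Z) l :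
    table2 i k (class_lam l) ((k - j)%N%:R * lx ^+ 3)
| Table2E' (j : nat) l of (2 <= j <= k - 2)%N
    & setE' (2 * i%:Z + j%:Z) (i%:Z + j%:Z) l :
    table2 i k (class_lam l) ((k - 1 - j)%N%:R * lx ^+ 3)
| Table2lam (j : nat) of (1 <= j <= k)%N :
    table2 i k (class_lam (rt (2 * i%:Z - 1 + j%:Z) (i%:Z + j%:Z)))
      ((k - j)%N%:R * lx ^+ 3 + lx)
| Table2l (l : int) of 2 - 2 * i%:Z <= l <= i%:Z - 1 :
    table2 i k (class_i l) (k%:R * lx ^+ 2)
| Table2i : table2 i k (class_i i%:Z) (k%:R * lx ^+ 2 + 1)
| Table2lo (j : nat) of (1 <= j <= k - 1)%N :
    table2 i k (class_i (2 - 2 * i%:Z - j%:Z)) ((k - j)%N%:R * lx ^+ 2)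
| Table2hi (j : nat) of (1 <= j <= k - 1)%N :
    table2 i k (class_i (i%:Z + j%:Z)) ((k - j)%N%:R * lx ^+ 2)
| Table2id : table2 i k class_id (k%:R * lx)
| Table2lam0 : table2 i k (class_lam (rt (2 * i%:Z - 1) i%:Z)) lx.

Inductive table3 (i k : nat) : conjclass -> laurent -> Prop :=
| Table3E (j : nat) l of (2 <= j <= i - 1)%N
    & setE (2 * j%:Z - 1) j%:Z l :
    table3 i k (class_lam l) ((k + 1)%N%:R * lx ^+ 3)
| Table3Ei l of setE (2 * i%:Z - 1) i%:Z l :
    table3 i k (class_lam l) ((k + 1)%N%:R * lx ^+ 3 + lx)
| Table3Eij (j : nat) l of (1 <= j <= k)%N
    & setE (2 * i%:Z - 1 + j%:Z) (i%:Z + j%:Z) l :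
    table3 i k (class_lam l) ((k + 1 - j)%N%:R * lx ^+ 3)
| Table3E' (j : nat) l of (2 <= j <= k - 1)%N
    & setE' (2 * i%:Z + j%:Z) (i%:Z + j%:Z) l :
    table3 i k (class_lam l) ((k - j)%N%:R * lx ^+ 3)
| Table3lam (j : nat) of (1 <= j <= k)%N :
    table3 i k (class_lam (rt (2 * i%:Z - 1 + j%:Z) (i%:Z + j%:Z)))
      ((k + 1 - j)%N%:R * lx ^+ 3 + lx)
| Table3l (l : int) of 2 - 2 * i%:Z <= l <= i%:Z - 1 :
    table3 i k (class_i l) ((k + 1)%N%:R * lx ^+ 2)
| Table3i : table3 i k (class_i i%:Z) ((k + 1)%N%:R * lx ^+ 2 + 1)
| Table3lo (j : nat) of (1 <= j <= k)%N :
    table3 i k (class_i (2 - 2 * i%:Z - j%:Z)) ((k + 1 - j)%N%:R * lx ^+ 2)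
| Table3hi (j : nat) of (1 <= j <= k)%N :
    table3 i k (class_i (i%:Z + j%:Z)) ((k + 1 - j)%N%:R * lx ^+ 2)
| Table3id : table3 i k class_id ((k + 1)%N%:R * lx)
| Table3lam0 : table3 i k (class_lam (rt (2 * i%:Z - 1) i%:Z)) lx.

(* Main.v *)
(** Reduce along conjugations by simple reflections: modulo commutators T_w
    equals T_(sws) if sws has the length of w, and T_(sws) + x T_(sw) if it is
    shorter by 2. Up to conjugation by tau the class O_(J,tau) is a chain indexed
    by an integer k, on which s1 acts by k |-> J - k and s2 by k |-> J + 1 - k.
    Near the bottom of the chain the s2-moves preserve the length and each s1-move
    contributes one translation, which is (1). Further up every s2-move lengthens
    as well and contributes an element of O_(id,tau). Such an element descends to
    tau through elements of the O_(l,tau) near the bottom of their chains, so its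
    expansion is 1 on O_(id,tau), x on an interval of the O_(l,tau) and x^2 on the
    O_(lambda,tau) in a quadrilateral; (2) and (3) add up these contributions. *)
Require Import Defs.
From mathcomp Require Import all_boot all_order all_algebra all_fingroup.
From mathcomp Require Import finmap classical_sets.
From mathcomp Require Import boolp zify ring.
Import Order.TTheory GRing.Theory Num.Theory.
Set Implicit Arguments.
Unset Strict Implicit.
Unset Printing Implicit Defensive.
Local Open Scope ring_scope.

(** * The length function on the extended affine Weyl group *)

Lemma S3P (P : 'S_3 -> Prop) : P 1%g -> P p1 -> P p2 -> P (p1 * p2)%g ->
  P (p2 * p1)%g -> P (p1 * p2 * p1)%g -> forall w, P w.
Proof.
move=> H1 H2 H3 H4 H5 H6 w.
suff: [\/ w = 1, w = p1, w = p2 | [\/ w = p1 * p2, w = p2 * p1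
   | w = p1 * p2 * p1]]%g by case=> [->|->|->|[->|->|->]].
elim/S3_ind: w => [|u|u].
- by constructor 1.
- case=> [->|->|->|[->|->|->]].
  + by rewrite mulg1; constructor 2.
  + by rewrite p1K; constructor 1.
  + by constructor 4; constructor 1.
  + by rewrite mulgA p1K mul1g; constructor 3.
  + by rewrite mulgA; constructor 4; constructor 3.
  + by rewrite !mulgA p1K mul1g; constructor 4; constructor 2.
- case=> [->|->|->|[->|->|->]].
  + by rewrite mulg1; constructor 3.
  + by constructor 4; constructor 2.
  + by rewrite p2K; constructor 1.
  + by rewrite mulgA -p1p2p1; constructor 4; constructor 3.
  + by rewrite mulgA p2K mul1g; constructor 2.
  + by rewrite p1p2p1 !mulgA p2K mul1g; constructor 4; constructor 1.
Qed.

(* The Iwahori-Matsumoto length formula; lengthE identifies it with length. *)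
Definition inverts (w : 'S_3) (i j : 'I_3) : int := (w j < w i)%N%:R.

Definition ell (x : extW) : nat :=
  (absz ((tpart x).1 - inverts (wpart x) i0 i1)%R +
   absz ((tpart x).2 - inverts (wpart x) i1 i2)%R +
   absz ((tpart x).1 + (tpart x).2 - inverts (wpart x) i0 i2)%R)%N.

Lemma ell_1 a b : ell (EW (a, b) 1%g) = (absz (a)%R + absz (b)%R + absz (a + b)%R)%N.
Proof. by rewrite /ell /inverts !perm1 /= !subr0. Qed.

Lemma ell_p1 a b : ell (EW (a, b) p1) = (absz (a - 1)%R + absz (b)%R + absz (a + b)%R)%N.
Proof. by rewrite /ell /inverts; do !rewrite permE /=; rewrite !subr0. Qed.

Lemma ell_p2 a b : ell (EW (a, b) p2) = (absz (a)%R + absz (b - 1)%R + absz (a + b)%R)%N.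
Proof. by rewrite /ell /inverts; do !rewrite permE /=; rewrite !subr0. Qed.

Lemma ell_p12 a b :
  ell (EW (a, b) (p1 * p2)%g) = (absz (a - 1)%R + absz (b)%R + absz (a + b - 1)%R)%N.
Proof. by rewrite /ell /inverts; do !rewrite permE /=; rewrite !subr0. Qed.

Lemma ell_p21 a b :
  ell (EW (a, b) (p2 * p1)%g) = (absz (a)%R + absz (b - 1)%R + absz (a + b - 1)%R)%N.
Proof. by rewrite /ell /inverts; do !rewrite permE /=; rewrite !subr0. Qed.

Lemma ell_p121 a b :
  ell (EW (a, b) (p1 * p2 * p1)%g) =
    (absz (a - 1)%R + absz (b - 1)%R + absz (a + b - 1)%R)%N.
Proof. by rewrite /ell /inverts; do !rewrite permE /=. Qed.

Definition ellE := (ell_1, ell_p1, ell_p2, ell_p12, ell_p21, ell_p121).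

Lemma p1M w : (p1 * (p1 * w) = w)%g. Proof. by rewrite mulgA p1K mul1g. Qed.
Lemma p2M w : (p2 * (p2 * w) = w)%g. Proof. by rewrite mulgA p2K mul1g. Qed.
Lemma p212 : (p2 * (p1 * p2) = p1 * p2 * p1)%g.
Proof. by rewrite p1p2p1 mulgA. Qed.
Lemma p2121 : (p2 * (p1 * p2 * p1) = p1 * p2)%g.
Proof. by rewrite p1p2p1 -!mulgA p2M. Qed.
Lemma p1121 : (p1 * (p1 * p2 * p1) = p2 * p1)%g.
Proof. by rewrite -!mulgA p1M. Qed.

Lemma p1_21 : (p1 * (p2 * p1) = p1 * p2 * p1)%g.
Proof. by rewrite mulgA. Qed.

(** These rules return a left product by [p1] or [p2] to one of the six normal forms of [S3P], where
    [ellE] applies; [p_simpr] does so for right products. *)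
Definition p_simp := (p1M, p2M, p1K, p2K, p212, p2121, p1121, p1_21,
  (fun w : 'S_3 => mulg1 w), (fun w : 'S_3 => mul1g w)).

Lemma s1M a b w : (s1 * EW (a, b) w)%g = EW (- a, a + b) (p1 * w)%g.
Proof. by rewrite EWM wact_p1 add0r. Qed.
Lemma s2M a b w : (s2 * EW (a, b) w)%g = EW (a + b, - b) (p2 * w)%g.
Proof. by rewrite EWM wact_p2 add0r. Qed.
Lemma s0M a b w : (s0 * EW (a, b) w)%g = EW (1 - b, 1 - a) (p1 * (p2 * (p1 * w)))%g.
Proof.
rewrite s0E EWM !wactM !(wact_p1, wact_p2) /= !mulgA; congr (EW (_, _) _) => /=; ring.
Qed.
Lemma tauM a b w : (tau * EW (a, b) w)%g = EW (1 - a - b, a) (p1 * (p2 * w))%g.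
Proof.
rewrite tauE EWM !wactM !(wact_p1, wact_p2) /= !mulgA; congr (EW (_, _) _) => /=; ring.
Qed.

Lemma simpleK i : (simple i * simple i = 1)%g.
Proof.
move: i; apply: ord3P; [|exact: s1K|exact: s2K].
change (s0 * s0 = 1)%g; rewrite [X in (_ * X)%g]s0E s0M p1121 p2M p1K.
by rewrite subrr.
Qed.

Lemma ell_simpleM i x : (ell (simple i * x)%g <= (ell x).+1)%N.
Proof.
case: x => -[a b] w; move: i w; apply: ord3P; apply: S3P;
  rewrite ?s0M ?s1M ?s2M ?p_simp ?ellE; lia.
Qed.

Lemma ell_tauM x : ell (tau * x)%g = ell x.
Proof.
case: x => -[a b] w; move: w; apply: S3P; rewrite tauM ?p_simp ?ellE; lia.
Qed.

Lemma ell1 : ell 1%g = 0%N.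
Proof. exact: (ell_1 0 0). Qed.

Lemma ell_tauX j : ell (tau ^+ j)%g = 0%N.
Proof. by elim: j => [|j IH]; rewrite ?expg0 ?ell1 // expgS ell_tauM. Qed.

Lemma ell_eq0 x : ell x = 0%N -> exists j, x = (tau ^+ j)%g.
Proof.
have t1 : (tau ^+ 1)%g = EW (1, 0) (p1 * p2)%g by rewrite expg1 tauE.
have t2 : (tau ^+ 2)%g = EW (0, 1) (p2 * p1)%g.
  by rewrite expgS t1 tauM p212 p1121.
case: x => -[a b] w; move: w; apply: S3P; rewrite ellE => E0.
- by exists 0%N; congr (EW (_, _) _); lia.
- exfalso; lia.
- exfalso; lia.
- by exists 1%N; rewrite t1; congr (EW (_, _) _); lia.
- by exists 2; rewrite t2; congr (EW (_, _) _); lia.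
- exfalso; lia.
Qed.

Lemma ell_descent x : (0 < ell x)%N ->
  exists i, ell x = (ell (simple i * x)%g).+1.
Proof.
suff H : ell x = 0%N \/ exists i, ell x = (ell (simple i * x)%g).+1.
  by case: H => // ->.
suff H : ell x = 0%N \/ ell x = (ell (s0 * x)%g).+1 \/
    ell x = (ell (s1 * x)%g).+1 \/ ell x = (ell (s2 * x)%g).+1.
  by case: H => [|[H|[H|H]]]; [left|right; exists i0|right; exists i1|right; exists i2].
case: x => -[a b] w; move: w; apply: S3P;
  rewrite ?s0M ?s1M ?s2M ?p_simp ?ellE; lia.
Qed.

(** Descents lead from x to a power of [tau], giving a word with [ell x] letters; conversely a
    simple factor raises [ell] by at most one and powers of [tau] have [ell] zero. *)
Lemma lengthE x : length x = ell x.
Proof.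
apply/eqP; rewrite eqn_leq; apply/andP; split.
  rewrite /length; case: ex_minnP => n _; apply.
  have [m def_m] : exists m, ell x = m by exists (ell x).
  rewrite def_m.
  suff [s [j [sz ->]]] : exists (s : seq 'I_3) (j : nat), size s = m /\
      x = ((\prod_(i <- s) simple i) * tau ^+ j)%g.
    rewrite -sz; apply/existsP; exists (in_tuple s).
    apply/existsP; exists (Ordinal (ltn_pmod j (isT : 0 < 3)%N)) => /=.
    by rewrite {1}(divn_eq j 3) mulnC expgnDr expgnA tau3 expg1n mul1g.
  elim: m x def_m => [|m IH] x def_m.
    have [j ->] := ell_eq0 def_m.
    by exists [::], j; rewrite big_nil mul1g.
  have [|i] := @ell_descent x; first by rewrite def_m.
  rewrite def_m => -[def_m'].
  have [s [j [sz Es]]] := IH _ (esym def_m').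
  exists (i :: s), j; rewrite /= sz big_cons -mulgA -Es mulgA.
  by rewrite simpleK mul1g.
rewrite /length; case: ex_minnP => n /existsP[s /existsP[j /eqP->]] _.
rewrite -{2}(size_tuple s); elim: (tval s) => [|i r IH].
  by rewrite big_nil mul1g ell_tauX.
rewrite big_cons -mulgA; exact: leq_trans (ell_simpleM _ _) _.
Qed.

Lemma p12_1 w : (w * p1 * p1 = w)%g. Proof. by rewrite -mulgA p1K mulg1. Qed.
Lemma p12_2 w : (w * p2 * p2 = w)%g. Proof. by rewrite -mulgA p2K mulg1. Qed.
Lemma p121_2 : (p1 * p2 * p1 * p2 = p2 * p1)%g.
Proof. by rewrite p1p2p1 p12_2. Qed.
Lemma p21_2 : (p2 * p1 * p2 = p1 * p2 * p1)%g.
Proof. by rewrite p1p2p1. Qed.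

Definition p_simpr := (p12_1, p12_2, p1K, p2K, p121_2, p21_2,
  (fun w : 'S_3 => mulg1 w), (fun w : 'S_3 => mul1g w)).

Lemma Ms1 l w : (EW l w * s1)%g = EW l (w * p1)%g.
Proof. by rewrite EWM wact0 addr0. Qed.
Lemma Ms2 l w : (EW l w * s2)%g = EW l (w * p2)%g.
Proof. by rewrite EWM wact0 addr0. Qed.

Lemma ell_Msimple i x : (ell (x * simple i)%g <= (ell x).+1)%N.
Proof.
case: x => -[a b] w; move: i; apply: ord3P; move: w; apply: S3P.
1-6: change (simple i0) with s0.
7-12: change (simple i1) with s1.
13-18: change (simple i2) with s2.
all: rewrite ?s0E ?Ms1 ?Ms2 ?[(EW (a, b) _ * _)%g]EWM ?wactM.
all: rewrite ?(wact1, wact_p1, wact_p2) ?mulgA ?p_simpr ?ellE /=; lia.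
Qed.

Lemma ell_Mtau x : ell (x * tau)%g = ell x.
Proof.
case: x => -[a b] w; rewrite tauE EWM; move: w; apply: S3P;
rewrite ?wactM ?(wact1, wact_p1, wact_p2) ?mulgA ?p_simpr ?ellE /=; lia.
Qed.

(** * Congruence modulo commutators and the Hecke relations *)

Section Commutators.
Variable H : algType laurent.
Implicit Types a b c : H.

Definition eqc a b := commutator_span (a - b).

Lemma commutator_span0 : commutator_span (0 : H).
Proof. by exists [::]; rewrite big_nil. Qed.

Lemma commutator_spanD a b :
  commutator_span a -> commutator_span b -> commutator_span (a + b).
Proof. by move=> [s ->] [t ->]; exists (s ++ t); rewrite big_cat. Qed.

Lemma commutator_spanZ k a : commutator_span a -> commutator_span (k *: a).
Proof.
move=> [s ->]; exists [seq (k * e.1.1, e.1.2, e.2) | e <- s].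
by rewrite big_map scaler_sumr; apply: eq_bigr => c _; rewrite scalerA.
Qed.

Lemma eqc_refl a : eqc a a.
Proof. by rewrite /eqc subrr; apply: commutator_span0. Qed.

Lemma eqc_sym a b : eqc a b -> eqc b a.
Proof.
by move=> ab; rewrite /eqc -opprB -scaleN1r; apply: commutator_spanZ.
Qed.

Lemma eqc_trans b a c : eqc a b -> eqc b c -> eqc a c.
Proof.
by move=> ab bc; rewrite /eqc -(subrKA b); apply: commutator_spanD.
Qed.

Lemma eqcD a a' b b' : eqc a a' -> eqc b b' -> eqc (a + b) (a' + b').
Proof. by move=> aa bb; rewrite /eqc opprD addrACA; apply: commutator_spanD. Qed.

Lemma eqcZ k a a' : eqc a a' -> eqc (k *: a) (k *: a').
Proof. by move=> aa; rewrite /eqc -scalerBr; apply: commutator_spanZ. Qed.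

Lemma eqcM a b : eqc (a * b) (b * a).
Proof. by exists [:: (1, a, b)]; rewrite big_seq1 scale1r. Qed.

End Commutators.

Section HeckeRelations.
Variables (H : algType laurent) (T : extW -> H).
Hypothesis hT : is_hecke_algebra T.

Lemma TM x y : (ell x + ell y)%N = ell (x * y)%g -> T x * T y = T (x * y)%g.
Proof. by rewrite -!lengthE; apply: hecke_mul. Qed.

Lemma ell_simple i : ell (simple i) = 1%N.
Proof.
move: i; apply: ord3P; [change (ell s0 = 1%N)|change (ell s1 = 1%N)|
  change (ell s2 = 1%N)]; by rewrite ?s0E ?ellE.
Qed.

Lemma TsqE i : T (simple i) * T (simple i) = 1 + lx *: T (simple i).
Proof.
have /eqP := hecke_quad hT i.
rewrite mulrBl subr_eq0 !mulrDr -!scalerAl -!scalerAr !mul1r !mulr1 scalerA lvK.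
set t := T _ => /eqP E; apply: (addIr (lvi *: t)).
by rewrite E /lx scalerBl scale1r -addrA subrK addrC.
Qed.

Lemma T_swap i y : ell (simple i * y)%g = (ell y).+1 ->
  ell (y * simple i)%g = (ell y).+1 ->
  eqc (T (simple i * y)%g) (T (y * simple i)%g).
Proof.
move=> h1 h2; rewrite -!TM ?h1 ?h2 ?ell_simple ?addn1 //; exact: eqcM.
Qed.

(** Moving the left factor [T (simple i)] to the far right modulo commutators creates its square,
    which the quadratic relation expands. *)
Lemma T_reduce i u : ell (simple i * u * simple i)%g = (ell u).+2 ->
  eqc (T (simple i * u * simple i)%g) (T u + lx *: T (u * simple i)%g).
Proof.
move=> h2.
have h1 : ell (u * simple i)%g = (ell u).+1.
  have := ell_simpleM i (u * simple i)%g; rewrite mulgA h2 ltnS => le2.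
  by apply/eqP; rewrite eqn_leq ell_Msimple.
have TuM : T u * T (simple i) = T (u * simple i)%g.
  by rewrite TM // h1 ell_simple addn1.
rewrite -mulgA -[T (simple i * _)%g]TM; last by rewrite ell_simple h1 mulgA h2.
apply: eqc_trans (eqcM _ _) _.
rewrite -TuM -mulrA TsqE mulrDr mulr1 -scalerAr; exact: eqc_refl.
Qed.

Lemma T_tau y : eqc (T (tau * y)%g) (T (y * tau)%g).
Proof.
have t0 : ell tau = 0%N by rewrite tauE ellE.
rewrite -[T (tau * y)%g]TM ?t0 ?ell_tauM //.
rewrite -[T (y * tau)%g]TM ?t0 ?addn0 ?ell_Mtau //; exact: eqcM.
Qed.
End HeckeRelations.

(** * Explicit elements and the conjugation moves between them *)

(* The three families of elements of O_(J,tau), in the order of the paper;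
   conjugation by tau permutes them. *)
Definition type1 (J k : int) : extW := EW (2 * k - J, 2 * J - k - 1) p1.
Definition type2 (J k : int) : extW :=
  EW (k + 2 * J - 1, k - J + 1) (p1 * p2 * p1)%g.
Definition type3 (J k : int) : extW := EW (1 - 2 * J - k, 2 * k + J) p2.
(* cyc and cycV are the elements of O_(id,tau), for the admissible residues of
   (m, n) modulo 3. *)
Definition cyc (m n : int) : extW := EW (m, n) (p2 * p1)%g.
Definition cycV (m n : int) : extW := EW (m, n) (p1 * p2)%g.

Ltac ew_norm :=
  rewrite /type1 /type2 /type3 /cyc /cycV ?(s0M, s1M, s2M, tauM) ?Ms1 ?Ms2;
  rewrite ?s0E ?tauE ?[(EW (_, _) _ * _)%g]EWM ?wactM;
  rewrite ?(wact1, wact_p1, wact_p2) ?mulgA ?p_simpr.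
Ltac ew_eq := ew_norm; congr (EW (_, _) _) => /=; lia.
Ltac ew_len := ew_norm; rewrite ?ellE /=; lia.

Section ExplicitReductions.
Variables (H : algType laurent) (T : extW -> H).
Hypothesis hT : is_hecke_algebra T.

(** Removing the simple factor on the side where this shortens x leaves y with x = s y or x = y s;
    since the lengths agree, both products are reduced and [T_swap] applies. *)
Lemma T_conj i x : ell (simple i * x * simple i)%g = ell x ->
  (ell (simple i * x)%g < ell x)%N \/ (ell (x * simple i)%g < ell x)%N ->
  eqc (T x) (T (simple i * x * simple i)%g).
Proof.
move=> E [lt|lt].
- have E1 : ell x = (ell (simple i * x)%g).+1.
    apply/eqP; rewrite eqn_leq lt andbT.
    by have := ell_simpleM i (simple i * x)%g; rewrite mulgA simpleK mul1g.
  have := @T_swap _ _ hT i (simple i * x)%g.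
  by rewrite mulgA simpleK mul1g => h; apply: h => //; by rewrite E E1.
- have E1 : ell x = (ell (x * simple i)%g).+1.
    apply/eqP; rewrite eqn_leq lt andbT.
    by have := ell_Msimple i (x * simple i)%g; rewrite -mulgA simpleK mulg1.
  have := @T_swap _ _ hT i (x * simple i)%g.
  rewrite mulgA -[(x * _ * _)%g]mulgA simpleK mulg1 => h.
  by apply/eqc_sym/h; rewrite ?mulgA ?E.
Qed.

Lemma T_reduceL i x : (ell (simple i * x * simple i)%g).+2 = ell x ->
  eqc (T x) (T (simple i * x * simple i)%g + lx *: T (simple i * x)%g).
Proof.
move=> E; have := @T_reduce _ _ hT i (simple i * x * simple i)%g.
rewrite E !mulgA simpleK mul1g -!mulgA simpleK mulg1 => h.
exact: h.
Qed.

Lemma T_rot x y : (tau * x = y * tau)%g -> eqc (T x) (T y).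
Proof.
move=> E; apply: eqc_sym; have := @T_tau _ _ hT (x * tau^-1)%g.
by rewrite mulgA E mulgK mulgVK.
Qed.

Lemma T_conj_to i x y : (simple i * x * simple i)%g = y -> ell y = ell x ->
  (ell (simple i * x)%g < ell x)%N \/ (ell (x * simple i)%g < ell x)%N ->
  eqc (T x) (T y).
Proof. by move=> <- E; apply: T_conj. Qed.

Lemma T_reduce_to i x y z : (simple i * x * simple i)%g = y ->
  (simple i * x)%g = z -> (ell y).+2 = ell x ->
  eqc (T x) (T y + lx *: T z).
Proof. by move=> <- <-; apply: T_reduceL. Qed.

Lemma T_type2 J k : eqc (T (type2 J k)) (T (type1 J (1 - k))).
Proof. by apply: T_rot; ew_eq. Qed.

Lemma T_type3 J k : eqc (T (type3 J k)) (T (type1 J (k + J))).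
Proof. by apply/eqc_sym/T_rot; ew_eq. Qed.

(** The s1-move changes only one of the three terms of the length, from 2k - J + 1 to 2k - J - 1. By
    [class_lam_repr] the translation split off represents [class_lam (rt k J)]. *)
Lemma T_type1_up J k : J + 1 <= 2 * k ->
  eqc (T (type1 J (J - k)))
      (T (type1 J k) + lx *: T (trans (2 * k - J, 2 * J - k - 1))).
Proof.
move=> le_Jk; apply: (@T_reduce_to i1); change (simple i1) with s1.
- by ew_eq.
- by rewrite /trans; ew_eq.
- by ew_len.
Qed.

(** Conjugation by s2 leads to [type2], and tau back to [type1]. In these ranges one of the terms
    |2J - k - 1| and |k + J - 1| grows by one while the other shrinks by one; in [T_type1_steep]
    both shrink. *)
Lemma T_type1_flat J k : (2 - J <= k <= 2 * J - 1) || (2 * J <= k <= 1 - J) ->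
  eqc (T (type1 J k)) (T (type1 J (J + 1 - k))).
Proof.
move=> bnd; apply: (@eqc_trans _ (T (type2 J (k - J)))).
  apply: (@T_conj_to i2); change (simple i2) with s2.
  - by ew_eq.
  - by ew_len.
  - by ew_len.
rewrite (_ : J + 1 - k = 1 - (k - J)); [exact: T_type2 | lia].
Qed.

Lemma T_type1_steep J k : 2 * J <= k -> 2 - J <= k ->
  eqc (T (type1 J k))
      (T (type1 J (J + 1 - k)) + lx *: T (cyc (k + J - 1) (k + 1 - 2 * J))).
Proof.
move=> le1 le2.
apply: (@eqc_trans _ (T (type2 J (k - J)) +
                      lx *: T (cyc (k + J - 1) (k + 1 - 2 * J)))).
  apply: (@T_reduce_to i2); change (simple i2) with s2.
  - by ew_eq.
  - by ew_eq.
  - by ew_len.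
apply: eqcD (eqc_refl _).
rewrite (_ : J + 1 - k = 1 - (k - J)); [exact: T_type2 | lia].
Qed.

(** Translations by a W-orbit have equal length. The sign of the reflected coordinate tells on which
    side the simple factor shortens; a zero coordinate gives a fixed point. *)
Lemma T_trans_conj w l : eqc (T (trans l)) (T (trans (wact w l))).
Proof.
have step i a b c d : (simple i * trans (a, b) * simple i)%g = trans (c, d) ->
    ell (trans (c, d)) = ell (trans (a, b)) ->
    [\/ trans (a, b) = trans (c, d),
      (ell (simple i * trans (a, b))%g < ell (trans (a, b)))%N |
      (ell (trans (a, b) * simple i)%g < ell (trans (a, b)))%N] ->
    eqc (T (trans (a, b))) (T (trans (c, d))).
  move=> E1 E2 [->|lt|lt]; first exact: eqc_refl.
  - by apply: (T_conj_to E1 E2); left.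
  - by apply: (T_conj_to E1 E2); right.
elim/S3_ind: w => [|w IH|w IH]; first by rewrite wact1; apply: eqc_refl.
- rewrite wactM wact_p1; apply: eqc_trans IH _.
  case: (wact w l) => a b /=.
  apply: (step i1); rewrite /trans; change (simple i1) with s1.
  + by ew_eq.
  + by ew_len.
  + case: (ltgtP a 0) => [lt|gt|->].
    * by constructor 2; ew_len.
    * by constructor 3; ew_len.
    * by constructor 1; rewrite oppr0 add0r.
- rewrite wactM wact_p2; apply: eqc_trans IH _.
  case: (wact w l) => a b /=.
  apply: (step i2); rewrite /trans; change (simple i2) with s2.
  + by ew_eq.
  + by ew_len.
  + case: (ltgtP b 0) => [lt|gt|->].
    * by constructor 2; ew_len.
    * by constructor 3; ew_len.
    * by constructor 1; rewrite oppr0 addr0.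
Qed.

Lemma T_cyc_rot m n : eqc (T (cyc m n)) (T (cyc (1 - m - n) (m + 1))).
Proof. by apply: T_rot; ew_eq. Qed.

(** In this and the four moves after it, the signs of the coordinates decide whether the length
    stays or drops by two; a drop splits off an element whose finite part is a reflection. *)
Lemma T_cyc_s0_down m n : 0 <= m -> 2 <= n ->
  eqc (T (cyc m n)) (T (cycV (3 - n) (- m)) + lx *: T (EW (1 - n, 1 - m) p2)).
Proof.
move=> m0 n2; apply: (@T_reduce_to i0); change (simple i0) with s0.
- by ew_eq.
- by ew_eq.
- by ew_len.
Qed.

Lemma T_cyc_s0_flat m n : n <= 1 -> 2 <= m + n ->
  eqc (T (cyc m n)) (T (cycV (3 - n) (- m))).
Proof.
move=> n1 mn2; apply: (@T_conj_to i0); change (simple i0) with s0.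
- by ew_eq.
- by ew_len.
- by left; ew_len.
Qed.

Lemma T_cyc_s2_down m n : 1 <= m -> n <= 0 ->
  eqc (T (cyc m n)) (T (cycV (m + n) (- n)) + lx *: T (EW (m + n, - n) p1)).
Proof.
move=> m1 n0; apply: (@T_reduce_to i2); change (simple i2) with s2.
- by ew_eq.
- by ew_eq.
- by ew_len.
Qed.

Lemma T_cycV_s2_down m n : n <= - 1 -> m + n <= 0 -> eqc (T (cycV m n))
  (T (cyc (m + n) (- n)) + lx *: T (EW (m + n, - n) (p1 * p2 * p1)%g)).
Proof.
move=> n1 mn0; apply: (@T_reduce_to i2); change (simple i2) with s2.
- by ew_eq.
- by ew_eq.
- by ew_len.
Qed.

Lemma T_cycV_s1_flat m n : 1 <= m -> 1 <= n ->
  eqc (T (cycV m n)) (T (cyc (- m) (m + n))).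
Proof.
move=> m1 n1; apply: (@T_conj_to i1); change (simple i1) with s1.
- by ew_eq.
- by ew_len.
- by right; ew_len.
Qed.

End ExplicitReductions.

(** * Conjugacy classes and their keys *)

(* Keys name the classes O_(id,tau), O_(l,tau) and, for a valid (a, b),
   O_(a alpha1 + b alpha2,tau), without repetition. *)
Notation key := (option (int + int * int)%type).
Notation kI l := (Some (inl l) : key).
Notation kL a b := (Some (inr (a, b)) : key).

Definition key_class (q : key) : conjclass :=
  match q with
  | None => class_id
  | Some (inl l) => class_i l
  | Some (inr (a, b)) => class_lam (rt a b)
  end.

(** Dominance of [(2 * a - b, 2 * b - a - 1)], the translation in the class. For dominant a alpha1 +
    b alpha2 this excludes exactly a = 2b, the excluded coweights 2m alpha1 + m alpha2. *)
Definition valid (q : key) : bool :=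
  if q is Some (inr (a, b)) then (b <= 2 * a) && (a + 1 <= 2 * b) else true.

Lemma class_iP J x : cc_set (class_i J) x <->
  exists k, [\/ x = type1 J k, x = type2 J k | x = type3 J k].
Proof.
by split=> -[k Hk]; exists k; move: Hk; have [-> -> ->] := set_iE J k.
Qed.

Lemma class_idP x : cc_set class_id x <-> exists m n,
  x = cycV (2 * m - n + 1) (2 * n - m) \/ x = cyc (2 * m - n - 1) (2 * n - m + 1).
Proof.
by split=> -[m [n Hmn]]; exists m, n; move: Hmn; have [-> ->] := set_idE m n.
Qed.

Lemma class_lam_repr a b :
  (trans (rt a b) * s2 * s1 * tau = trans (2 * a - b, 2 * b - a - 1)%R)%g.
Proof. by rewrite /trans rtE; ew_eq. Qed.

(** Translations commute, so only the finite part of the conjugating element acts. *)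
Lemma class_lamP a b x : cc_set (class_lam (rt a b)) x <->
  exists w, x = trans (wact w (2 * a - b, 2 * b - a - 1)).
Proof.
rewrite /class_lam class_lam_repr; set l := (_, _).
have tJ m u : (trans l ^ EW m u)%g = trans (wact u^-1%g l).
  have -> : EW m u = (trans m * EW 0 u)%g by rewrite /trans EWM mul1g wact0 addr0.
  have tm : (trans l * trans m = trans m * trans l)%g.
    by rewrite /trans !EWM !wact1 addrC.
  rewrite conjgM [(trans l ^ _)%g]conjgE tm mulKg conjgE.
  apply: (mulgI (EW 0 u)).
  by rewrite mulKVg /trans !EWM -wactM mulgV !wact1 !add0r addr0 mul1g mulg1.
split=> [[[m u] _ <-]|[w ->]]; first by exists u^-1%g; rewrite tJ.
by exists (EW 0 w^-1%g) => //; rewrite tJ invgK.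
Qed.

Lemma wact_dominant_inj w (a b c d : int) :
  0 <= a -> 0 <= b -> 0 <= c -> 0 <= d -> wact w (a, b) = (c, d) -> (a, b) = (c, d).
Proof.
move=> a0 b0 c0 d0; move: w; apply: S3P; rewrite ?wactM ?(wact1, wact_p1, wact_p2) /=;
  move=> [E1 E2]; congr pair; lia.
Qed.

(** The finite part (a 3-cycle, a reflection or the identity) separates the three kinds of class.
    Within a kind, the coordinates of a [type1] element determine l, and a W-orbit has only one
    dominant element. *)
Lemma key_class_inj q q' : valid q -> valid q' -> key_class q = key_class q' -> q = q'.
Proof.
have wI J k : wpart (type1 J k) i2 = i2 /\ wpart (type2 J k) i1 = i1 /\
    wpart (type3 J k) i0 = i0.
  by rewrite /type1 /type2 /type3; do !rewrite permE /=.
have notIL J a b : key_class (kI J) <> key_class (kL a b).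
  move=> /(congr1 cc_set) E.
  have : cc_set (class_i J) (type1 J 0) by apply/class_iP; exists 0; constructor 1.
  rewrite [cc_set _]E => /class_lamP[w /(congr1 wpart)/= /permP/(_ i0)].
  by rewrite !permE.
have notNI J : key_class None <> key_class (kI J).
  move=> /(congr1 cc_set) E.
  have : cc_set (class_i J) (type1 J 0) by apply/class_iP; exists 0; constructor 1.
  rewrite -[cc_set (class_i J)]E => /class_idP[m [n [] /(congr1 wpart)/= /permP/(_ i2)]];
  by do !rewrite permE /=.
have notNL a b : key_class None <> key_class (kL a b).
  move=> /(congr1 cc_set) E.
  have : cc_set class_id (cycV (2 * 0 - 0 + 1) (2 * 0 - 0)).
    by apply/class_idP; exists 0, 0; left.
  rewrite [cc_set _]E => /class_lamP[w /(congr1 wpart)/= /permP/(_ i0)].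
  by do !rewrite permE /=.
case: q => [[l|[a b]]|]; case: q' => [[l'|[a' b']]|] //= v v' E.
- move/(congr1 cc_set) : E => E.
  have : cc_set (class_i l) (type1 l 0) by apply/class_iP; exists 0; constructor 1.
  rewrite E => /class_iP[k [] X].
  + by case: X => E1 E2; congr (Some (inl _)); lia.
  + by move/(congr1 wpart)/permP/(_ i2): X; do !rewrite permE /=.
  + by move/(congr1 wpart)/permP/(_ i0): X; do !rewrite permE /=.
- by case: (notIL _ _ _ E).
- by case: (notNI _ (esym E)).
- by case: (notIL _ _ _ (esym E)).
- move/(congr1 cc_set) : E => E.
  have : cc_set (class_lam (rt a b)) (trans (2 * a - b, 2 * b - a - 1)).
    by apply/class_lamP; exists 1%g; rewrite wact1.
  rewrite E => /class_lamP[w /(congr1 tpart)/esym E1].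
  have [E2 E3] : (2 * a' - b', 2 * b' - a' - 1) = (2 * a - b, 2 * b - a - 1).
    by apply: wact_dominant_inj E1; lia.
  by congr (Some (inr (_, _))); lia.
- by case: (notNL _ _ (esym E)).
- by case: (notNI _ E).
- by case: (notNL _ _ E).
Qed.

Lemma big_supp_seq (I : eqType) (V : zmodType) (F : I -> V) (s t : seq I) :
  uniq s -> uniq t -> {subset s <= t} -> (forall x, x \notin s -> F x = 0) ->
  \sum_(x <- t) F x = \sum_(x <- s) F x.
Proof.
move=> us ut st F0; rewrite (bigID (mem s)) /= [X in _ + X]big1 // addr0.
rewrite -big_filter; apply: perm_big; apply: uniq_perm => //.
  exact: filter_uniq.
by move=> x; rewrite mem_filter andb_idr //; apply: st.
Qed.

(** * Expansions indexed by keys, and class polynomials *)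

Section Expansions.
Variables (H : algType laurent) (T : extW -> H).
Hypothesis hT : is_hecke_algebra T.
Implicit Types g : key -> laurent.

(** Coefficients live on keys, so that contributions add pointwise and are compared by integer
    inequalities; s is any finite list of valid keys containing the support. *)
Definition expands (h : H) g := exists s : seq key,
  [/\ uniq s, all valid s, forall q, q \notin s -> g q = 0 &
    forall r, (forall O, is_min_length O (r O)) ->
      eqc h (\sum_(q <- s) g q *: T (r (key_class q)))].

Lemma expands_ext h g g' : g =1 g' -> expands h g -> expands h g'.
Proof.
move=> E [s [us vs g0 hs]]; exists s; split=> // [q /g0|r /hs]; first by rewrite E.
by under eq_bigr do rewrite E.
Qed.

Lemma expands_eqc h h' g : eqc h h' -> expands h' g -> expands h g.
Proof.
move=> E [s [us vs g0 hs]]; exists s; split=> // r /hs; exact: eqc_trans.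
Qed.

Lemma expandsD h h' g g' : expands h g -> expands h' g' ->
  expands (h + h') (fun q => g q + g' q).
Proof.
move=> [s [us vs g0 hs]] [t [ut vt g0' ht]].
have ss : {subset s <= undup (s ++ t)}.
  by move=> q qs; rewrite mem_undup mem_cat qs.
have st : {subset t <= undup (s ++ t)}.
  by move=> q qs; rewrite mem_undup mem_cat qs orbT.
exists (undup (s ++ t)); split=> [||q|r rP].
- exact: undup_uniq.
- by apply/allP=> q; rewrite mem_undup mem_cat => /orP[]; apply/allP.
- by rewrite mem_undup mem_cat negb_or => /andP[/g0-> /g0'->]; rewrite addr0.
- under eq_bigr do rewrite scalerDl.
  rewrite big_split /=; apply: eqcD.
  + rewrite (big_supp_seq us) ?undup_uniq //; first exact: hs.
    by move=> q /g0->; rewrite scale0r.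
  + rewrite (big_supp_seq ut) ?undup_uniq //; first exact: ht.
    by move=> q /g0'->; rewrite scale0r.
Qed.

Lemma expandsZ c h g : expands h g -> expands (c *: h) (fun q => c * g q).
Proof.
move=> [s [us vs g0 hs]]; exists s; split=> // [q /g0->|r /hs E].
  by rewrite mulr0.
under eq_bigr do rewrite -scalerA.
by rewrite -scaler_sumr; apply: eqcZ.
Qed.

Lemma expands_step h h1 h2 g1 g2 g : eqc h (h1 + lx *: h2) ->
  expands h1 g1 -> expands h2 g2 -> (forall q, g1 q + lx * g2 q = g q) ->
  expands h g.
Proof.
move=> E e1 e2 Eg; apply: expands_eqc E _; apply: expands_ext Eg _.
by apply: expandsD => //; apply: expandsZ.
Qed.

Lemma expands1 h q0 g : valid q0 -> g q0 = 1 -> (forall q, q != q0 -> g q = 0) ->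
  (forall x, is_min_length (key_class q0) x -> eqc h (T x)) -> expands h g.
Proof.
move=> v0 g1 g0 hr; exists [:: q0]; split=> // [|q|r rP]; first by rewrite /= v0.
- by rewrite inE; apply: g0.
- by rewrite big_seq1 g1 scale1r; apply: hr.
Qed.

(** Transported to classes, g becomes a finitely supported expansion of [T x], and the uniqueness in
    [is_class_poly] identifies it with f. *)
Lemma class_poly_expands x g f : expands (T x) g -> is_class_poly T x f ->
  (forall q, valid q -> f (key_class q) = g q) /\
  (forall O, (forall q, valid q -> O <> key_class q) -> f O = 0).
Proof.
move=> [s [us vs g0 hs]] [_ f_uniq].
pose t := [seq key_class q | q <- s].
have inj_s : {in s &, injective key_class}.
  by move=> q q' /(allP vs) v /(allP vs) v'; apply: key_class_inj.
(* At most one term of this sum survives, by injectivity of [key_class] on valid keys; the sum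
   avoids choosing an inverse. *)
pose f' : {fsfun conjclass -> laurent with 0} :=
  [fsfun O in seq_fset tt t => \sum_(q <- s | key_class q == O) g q].
have f'0 O : O \notin t -> f' O = 0.
  by move=> tO; rewrite fsfunE seq_fsetE (negPf tO).
have f'E q : valid q -> f' (key_class q) = g q.
  move=> vq; case: (boolP (q \in s)) => [qs|nqs].
    rewrite fsfunE seq_fsetE map_f //= big_mkcond (bigD1_seq q) ?eqxx //=.
    rewrite big1_seq ?addr0 //.
    move=> q' /andP[nE q's]; case: eqP => // /inj_s E.
    by rewrite E ?eqxx in nE.
  rewrite g0 //; apply: f'0; apply/mapP=> -[q' q's E].
  by case/negP: nqs; rewrite (key_class_inj vq (allP vs _ q's) E).
suff : class_expansion T x f'.
  move=> /f_uniq ->; split=> // O nO; apply: f'0; apply/mapP=> -[q qs].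
  exact/nO/(allP vs).
move=> r /hs; rewrite /eqc.
suff -> : \sum_(O <- finsupp f') f' O *: T (r O) =
  \sum_(q <- s) g q *: T (r (key_class q)) by [].
rewrite -(@big_supp_seq _ _ _ (finsupp f') t) ?fset_uniq //.
- rewrite big_map big_seq [RHS]big_seq; apply: eq_bigr => q qs.
  by rewrite f'E //; apply: (allP vs).
- by rewrite map_inj_in_uniq.
- by move=> O; rewrite mem_finsupp; apply: contraNT => /f'0->.
- by move=> O; rewrite mem_finsupp negbK => /eqP->; rewrite scale0r.
Qed.

End Expansions.

Ltac coef_cases := repeat (case: ifP => ?); first [ring | exfalso; lia].

(** * Minimal lengths and the lower part of the chains *)

Lemma class_length_le O x : cc_set O x -> (class_length O <= length x)%N.
Proof.
move=> Ox; rewrite /class_length; case: ex_minnP => n _; apply.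
by apply/asboolP; exists x.
Qed.

Lemma class_i_ell J x : cc_set (class_i J) x ->
  exists k, ell x = ell (type1 J k).
Proof.
by move=> /class_iP[k [] ->]; [exists k|exists (1 - k)|exists (k + J)]; ew_len.
Qed.

Lemma type1_class J k : cc_set (class_i J) (type1 J k).
Proof. by apply/class_iP; exists k; constructor 1. Qed.

(** The bounds single out k = floor(J/2) + 1, where the length, a convex function of the chain
    index, is minimal. *)
Lemma type1_minimal J k x : J + 1 <= 2 * k <= J + 2 ->
  cc_set (class_i J) x -> (ell (type1 J k) <= ell x)%N.
Proof. by move=> Jk /class_i_ell[k' ->]; ew_len. Qed.

Lemma class_i_length J k : J + 1 <= 2 * k <= J + 2 ->
  class_length (class_i J) = ell (type1 J k).
Proof.
move=> Jk; apply/eqP; rewrite eqn_leq -lengthE class_length_le; last exact: type1_class.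
rewrite /class_length; case: ex_minnP => n /asboolP[x Ox <-] _.
by rewrite !lengthE type1_minimal.
Qed.

Section BasicExpansions.
Variables (H : algType laurent) (T : extW -> H).
Hypothesis hT : is_hecke_algebra T.

Lemma class_iP1 J x : cc_set (class_i J) x ->
  exists k, ell x = ell (type1 J k) /\ eqc (T x) (T (type1 J k)).
Proof.
move=> /class_iP[k [] ->].
- by exists k; split=> //; apply: eqc_refl.
- by exists (1 - k); split; [ew_len | apply: T_type2].
- by exists (k + J); split; [ew_len | apply: T_type3].
Qed.

Lemma expands_type1_minimal J k : J + 1 <= 2 * k <= J + 2 ->
  expands T (T (type1 J k))
    (fun q => if q is Some (inl l) then if l == J then 1 else 0 else 0).
Proof.
move=> Jk; apply: (@expands1 _ _ _ (kI J)) => //; first by rewrite eqxx.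
  by case=> [[l|//]|//] ne; case: eqP => // E; rewrite E eqxx in ne.
move=> x [Ox]; rewrite lengthE (class_i_length Jk) => Ex; apply: eqc_sym.
have [k' [Ek' Tx]] := class_iP1 Ox; apply: eqc_trans Tx _.
rewrite Ek' in Ex.
(* Only the bottom of the chain and its image under the s2-move attain the minimum, and that move is
   flat. *)
have [->|->] : k' = k \/ k' = J + 1 - k.
  by move: Ex; rewrite /type1 !ellE; lia.
  exact: eqc_refl.
by apply/eqc_sym/(T_type1_flat hT); lia.
Qed.

Lemma expands_trans w a b : valid (kL a b) ->
  expands T (T (trans (wact w (2 * a - b, 2 * b - a - 1))))
    (fun q => if q is Some (inr (c, d)) then if (c == a) && (d == b) then 1 else 0
              else 0).
Proof.
move=> ab; apply: (@expands1 _ _ _ (kL a b)) => //; first by rewrite !eqxx.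
  case=> [[//|[c d]]|//] ne; case: ifP => // /andP[/eqP Ec /eqP Ed].
  by rewrite Ec Ed eqxx in ne.
move=> x [/class_lamP[u ->]] _.
apply: (@eqc_trans _ (T (trans (2 * a - b, 2 * b - a - 1)%R))); last exact: T_trans_conj.
by apply: eqc_sym; apply: T_trans_conj.
Qed.

Lemma expands_tau : expands T (T tau) (fun q => if q is None then 1 else 0).
Proof.
apply: (@expands1 _ _ _ None) => //; first by case.
have t0 : ell tau = 0%N by rewrite tauE ellE.
have clt : cc_set class_id tau.
  by apply/class_idP; exists 0, 0; left; rewrite tauE.
move=> x [Ox Lx].
have : (ell x <= 0)%N by rewrite -t0 -!lengthE Lx class_length_le.
move/class_idP: Ox => [m [n [->|->]]]; rewrite /cyc /cycV ellE => le0.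
  rewrite tauE (_ : (_, _) = (1, 0)); first exact: eqc_refl.
  by congr pair; lia.
(* Length zero would mean 2m - n = 1 and m = 2n, hence 3n = 1. *)
by exfalso; lia.
Qed.

(* For J <= 0 the translations met along the chain are not dominant; their
   dominant representatives have first coordinate 1 - J instead of second
   coordinate J. *)
Definition flat_coef (J k : int) (q : key) : laurent :=
  match q with
  | None => 0
  | Some (inl l) => if l == J then 1 else 0
  | Some (inr (a, b)) =>
    if [&& 0 < J, b == J, J + 1 <= 2 * a & a < k]
    || [&& J <= 0, a == 1 - J, 2 - J <= 2 * b - 1 & b < k + 1 - J] then lx else 0
  end.

(** A flat s2-move takes k to J - (k - 1), and an s1-move then descends to k - 1, adding one
    translation. This repeats down to the bottom, where the intervals in [flat_coef] are empty. *)
Lemma expands_flat (J k : int) : J + 1 <= 2 * k ->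
  k <= 2 * J - 1 \/ k <= 1 - J ->
  expands T (T (type1 J k)) (flat_coef J k).
Proof.
move=> le_k; have [n le_n] : exists n : nat, 2 * k <= J + 2 + 2 * n%:Z.
  by exists (absz (2 * k - J)%R); lia.
elim: n k le_k le_n => [|n IH] k le_k le_n bnd;
  last case: (lerP (2 * k) (J + 2)) => k_min.
1,2: apply: expands_ext (expands_type1_minimal _); last by lia.
1,2: by case=> [[//|[a b]]|] //=; case: ifP => //; lia.
have [IH1 le_k1] : expands T (T (type1 J (k - 1))) (flat_coef J (k - 1)) /\
  J + 1 <= 2 * (k - 1) by split; [apply: IH; lia | lia].
apply: (expands_eqc (T_type1_flat hT _)); first by lia.
rewrite (_ : J + 1 - k = J - (k - 1)); last by lia.
have [J0|J0] := lerP J 0.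
  apply: expands_step (T_type1_up hT le_k1) IH1 _ _.
    (* For J <= 0 the translation is moved to its dominant conjugate, whose key is (1 - J, k -
       J). *)
    rewrite (_ : (_, _) = wact (p2 * p1)%g
      (2 * (1 - J) - (k - J), 2 * (k - J) - (1 - J) - 1)).
      by apply: expands_trans => /=; lia.
    by rewrite wactM wact_p1 wact_p2 /=; congr pair; lia.
  case=> [[l|[a b]]|] /=; rewrite ?mulr0 ?addr0 //.
  by coef_cases.
apply: expands_step (T_type1_up hT le_k1) IH1 _ _.
  rewrite -[(_, _)]wact1.
  by apply: (expands_trans 1%g (a := k - 1) (b := J)) => /=; lia.
case=> [[l|[a b]]|] /=; rewrite ?mulr0 ?addr0 //.
by coef_cases.
Qed.

End BasicExpansions.

(** * Expansions of elements of O_(id,tau) *)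

Section CycExpansions.
Variables (H : algType laurent) (T : extW -> H).
Hypothesis hT : is_hecke_algebra T.

(** The coefficients of [cyc (3 * i + K - 1) (K + 1)]: i is a position on the wall where the second
    coordinate is 1, and K counts diagonal steps away from it. *)
Definition cyc_coef (i K : int) (q : key) : laurent :=
  match q with
  | None => 1
  | Some (inl l) => if 2 - 2 * i - K <= l <= i + K then lx else 0
  | Some (inr (a, b)) =>
    if [&& b + 1 <= 2 * a, a + 2 <= 2 * b, b <= i + K & a <= 2 * i + K - 1]
    then lx ^+ 2 else 0
  end.

(** The elements split off by the cyc-moves often lie below the middle of their chain; a flat move
    reflects them into the range of [expands_flat]. *)
Lemma expands_type1_refl (J k : int) (J' : int) : J' = J + 1 - k ->
  J + 1 <= 2 * J' -> J' <= 2 * J - 1 \/ J' <= 1 - J ->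
  expands T (T (type1 J k)) (flat_coef J J').
Proof.
move=> -> le1 le2; apply: (expands_eqc _ (expands_flat hT le1 le2)).
by apply: (T_type1_flat hT); lia.
Qed.

(** One diagonal step, from K to K - 1: conjugation by s0, then by s2, each lowering the length by
    two, followed by a rotation by tau. *)
Lemma T_cyc_diag (i K : int) : 1 <= i -> 1 <= K ->
  eqc (T (cyc (3 * i + K - 1) (K + 1)))
    (T (cyc (3 * i + K - 2) K) + lx *: T (type1 (2 - 2 * i - K) (1 - i)) +
     lx *: T (type1 (i + K) (1 - i))).
Proof.
move=> i1 K1; apply: eqc_trans (T_cyc_s0_down hT _ _) _; [lia..|].
apply: eqcD; last first.
  apply: eqcZ; rewrite (_ : EW _ _ = type3 (i + K) (1 - 2 * i - K)); last by ew_eq.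
  rewrite (_ : 1 - i = 1 - 2 * i - K + (i + K)); last by lia.
  exact: T_type3.
apply: eqc_trans (T_cycV_s2_down hT _ _) _; [lia..|].
apply: eqcD; last first.
  apply: eqcZ; rewrite (_ : EW _ _ = type2 (2 - 2 * i - K) i); last by ew_eq.
  exact: T_type2.
apply: eqc_sym; apply: eqc_trans (T_cyc_rot hT _ _) _.
by rewrite (_ : cyc _ _ = cyc (3 - (K + 1) + - (3 * i + K - 1)) (- - (3 * i + K - 1)));
  [exact: eqc_refl | ew_eq].
Qed.

(** On the wall the s0-move of [T_cyc_diag] becomes flat, so only the s2-move contributes. *)
Lemma T_cyc_wall (i : int) : 1 <= i ->
  eqc (T (cyc (3 * i - 1) 1))
    (T (cyc (3 * i - 2) 0) + lx *: T (type1 (2 - 2 * i) (1 - i))).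
Proof.
move=> i1; apply: eqc_trans (T_cyc_s0_flat hT _ _) _; [lia..|].
apply: eqc_trans (T_cycV_s2_down hT _ _) _; [lia..|].
apply: eqcD; last first.
  apply: eqcZ; rewrite (_ : EW _ _ = type2 (2 - 2 * i) i); last by ew_eq.
  exact: T_type2.
apply: eqc_sym; apply: eqc_trans (T_cyc_rot hT _ _) _.
by rewrite (_ : cyc _ _ = cyc (3 - 1 + - (3 * i - 1)) (- - (3 * i - 1)));
  [exact: eqc_refl | ew_eq].
Qed.

(** Together with [T_cyc_wall] this passes from the wall element for i to the one for i - 1, since
    3(i - 1) - 1 = 3i - 4. *)
Lemma T_cyc_wall_next (i : int) : 2 <= i ->
  eqc (T (cyc (3 * i - 2) 0))
    (T (cyc (3 * i - 4) 1) + lx *: T (type1 i (2 * i - 2)) +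
     lx *: T (type1 (3 - 2 * i) (1 - i))).
Proof.
move=> i2; apply: eqc_trans (T_cyc_s0_flat hT _ _) _; [lia..|].
apply: eqc_trans (T_cycV_s2_down hT _ _) _; [lia..|].
apply: eqcD; last first.
  apply: eqcZ; rewrite (_ : EW _ _ = type2 (3 - 2 * i) i); last by ew_eq.
  exact: T_type2.
apply: (@eqc_trans _ (T (cyc (3 * i - 3) (- 1)))).
  apply: eqc_sym; apply: eqc_trans (T_cyc_rot hT _ _) _.
  by rewrite (_ : cyc _ _ = cyc (3 - 0 + - (3 * i - 2)) (- - (3 * i - 2)));
    [exact: eqc_refl | ew_eq].
apply: eqc_trans (T_cyc_s2_down hT _ _) _; [lia..|].
apply: eqcD; last first.
  by rewrite (_ : EW _ _ = type1 i (2 * i - 2)); [exact: eqc_refl | ew_eq].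
apply: eqc_trans (T_cycV_s1_flat hT _ _) _; [lia..|].
apply: eqc_sym; apply: eqc_trans (T_cyc_rot hT _ _) _.
by rewrite (_ : cyc _ _ = cyc (- (3 * i - 3 + -1)) (3 * i - 3 + -1 + - -1));
  [exact: eqc_refl | ew_eq].
Qed.

Lemma expands_cyc_wall (i : int) : 1 <= i ->
  expands T (T (cyc (3 * i - 1) 1)) (cyc_coef i 0).
Proof.
move=> i1; have [n def_i] : exists n : nat, i = n%:Z + 1.
  by exists (absz (i - 1)%R); lia.
elim: n i i1 def_i => [|n IH] i i1 def_i.
  rewrite {i i1}def_i add0r.
  (* For i = 1 the descent from [cyc 1 0] ends at once: [cycV 1 0] is [tau]. *)
  have E1 : eqc (T (cyc 1 0)) (T tau + lx *: T (type1 1 1)).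
    apply: eqc_trans (T_cyc_s2_down hT _ _) _; [lia..|].
    by rewrite tauE; apply: eqc_refl.
  have h1 := expands_step E1 (expands_tau T)
    (expands_type1_minimal hT (J := 1) (k := 1) isT) (fun q => erefl).
  have h2 : expands T (T (type1 0 0)) (flat_coef 0 1).
    by apply: expands_type1_refl; lia.
  apply: expands_step (T_cyc_wall (i := 1) isT) h1 h2 _.
  by case=> [[l|[a b]]|]; rewrite /flat_coef /cyc_coef; coef_cases.
have i2 : 2 <= i by lia.
have {}IH : expands T (T (cyc (3 * i - 4) 1)) (cyc_coef (i - 1) 0).
  by rewrite (_ : 3 * i - 4 = 3 * (i - 1) - 1); [apply: IH; lia | lia].
have h1 : expands T (T (type1 i (2 * i - 2))) (flat_coef i (2 * i - 2)).
  by apply: (expands_flat hT); lia.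
have h2 : expands T (T (type1 (3 - 2 * i) (1 - i))) (flat_coef (3 - 2 * i) (3 - i)).
  by apply: expands_type1_refl; lia.
have h3 : expands T (T (type1 (2 - 2 * i) (1 - i))) (flat_coef (2 - 2 * i) (2 - i)).
  by apply: expands_type1_refl; lia.
(* The intermediate coefficients stay unevaluated sums; only the last step compares them with
   [cyc_coef]. *)
have h4 := expands_step (eqc_refl _) IH h1 (fun q => erefl).
have h5 := expands_step (T_cyc_wall_next i2) h4 h2 (fun q => erefl).
apply: expands_step (T_cyc_wall _) h5 h3 _; first by lia.
by case=> [[l|[a b]]|]; rewrite /flat_coef /cyc_coef; coef_cases.
Qed.

Lemma expands_cyc (i : int) (K : nat) : 1 <= i ->
  expands T (T (cyc (3 * i + K%:Z - 1) (K%:Z + 1))) (cyc_coef i K%:Z).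
Proof.
move=> i1; elim: K => [|K IH].
  by rewrite addr0 add0r; apply: expands_cyc_wall.
have h1 : expands T (T (type1 (2 - 2 * i - K.+1%:Z) (1 - i)))
    (flat_coef (2 - 2 * i - K.+1%:Z) (1 - i)).
  by apply: (expands_flat hT); lia.
have h2 : expands T (T (type1 (i + K.+1%:Z) (1 - i)))
    (flat_coef (i + K.+1%:Z) (2 * i + K.+1%:Z)).
  by apply: expands_type1_refl; lia.
have {}IH : expands T (T (cyc (3 * i + K.+1%:Z - 2) K.+1%:Z)) (cyc_coef i K%:Z).
  rewrite (_ : 3 * i + K.+1%:Z - 2 = 3 * i + K%:Z - 1); last by lia.
  by rewrite (_ : K.+1%:Z = K%:Z + 1); last by lia.
have h3 := expands_step (eqc_refl _) IH h1 (fun q => erefl).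
apply: expands_step (T_cyc_diag _ _) h3 h2 _; [lia..|].
by case=> [[l|[a b]]|]; rewrite /flat_coef /cyc_coef; coef_cases.
Qed.

End CycExpansions.

(** * The upper part of the chain *)

(* cyc_coef i K is supported on the keys of depth at most K, so that keys of
   depth d receive K - d of the first K contributions. *)
Definition depth (i : int) (q : key) : nat :=
  match q with
  | None => 0%N
  | Some (inl l) => absz (Num.max 0 (Num.max (l - i) (2 - 2 * i - l)))
  | Some (inr (a, b)) => absz (Num.max 0 (Num.max (b - i) (a - 2 * i + 1)))
  end.

(** M counts the contributions of O_(id,tau) collected so far, E the translations met beyond those
    with second root coordinate i. *)
Definition chain_coef (i : int) (M E : nat) (q : key) : laurent :=
  match q with
  | None => (M - depth i q)%N%:R * lx
  | Some (inl l) => (if l == i then 1 else 0) + (M - depth i q)%N%:R * lx ^+ 2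
  | Some (inr (a, b)) =>
    (if (b + 1 <= 2 * a) && (a + 2 <= 2 * b) then (M - depth i q)%N%:R * lx ^+ 3
     else 0) +
    (if [&& b == i, i + 1 <= 2 * a & a <= 2 * i - 1]
     || [&& a - i + 1 == b, i < b & b <= i + E%:Z] then lx else 0)
  end.

Lemma natr_subSn (R : pzRingType) (M d : nat) :
  (M.+1 - d)%N%:R = (M - d)%N%:R + (if (d <= M)%N then 1 else 0) :> R.
Proof.
have -> : (M.+1 - d = (M - d) + (d <= M))%N by lia.
by rewrite natrD; case: leqP.
Qed.

Section Chain.
Variables (H : algType laurent) (T : extW -> H).
Hypothesis hT : is_hecke_algebra T.

(** The chain alternates: a steep s2-move takes 2i + K to 1 - i - K and raises M, and an s1-move
    takes 1 - i - (K + 1) to 2i + K and raises E. The start 1 - i lies one s1-move above 2i - 1, the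
    top of the flat stretch. *)
Lemma expands_chain (i : int) (K : nat) : 1 <= i ->
  expands T (T (type1 i (1 - i - K%:Z))) (chain_coef i K K) /\
  expands T (T (type1 i (2 * i + K%:Z))) (chain_coef i K.+1 K).
Proof.
move=> i1.
have up K' : expands T (T (type1 i (1 - i - K'%:Z))) (chain_coef i K' K') ->
    expands T (T (type1 i (2 * i + K'%:Z))) (chain_coef i K'.+1 K').
  move=> eK.
  have h : expands T (T (cyc (2 * i + K'%:Z + i - 1) (2 * i + K'%:Z + 1 - 2 * i)))
      (cyc_coef i K'%:Z).
    have := expands_cyc hT K' i1.
    by congr (expands T (T (cyc _ _)) _); lia.
  apply: expands_step (T_type1_steep hT _ _) _ h _; [lia..| |].
    by move: eK; congr (expands T (T (type1 _ _)) _); lia.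
  (* Raising M by one changes M - depth exactly at depth at most the old M, which matches the
     support of [cyc_coef]. *)
  case=> [[l|[a b]]|]; rewrite /chain_coef natr_subSn /cyc_coef /depth.
  - by move: (_ - _)%N%:R => x; coef_cases.
  - by move: (_ - _)%N%:R => x; coef_cases.
  - by rewrite leq0n; ring.
suff lo : expands T (T (type1 i (1 - i - K%:Z))) (chain_coef i K K).
  by split; [|apply: up].
elim: K => [|K IH].
  have h1 : expands T (T (type1 i (2 * i - 1))) (flat_coef i (2 * i - 1)).
    by apply: (expands_flat hT); lia.
  have h2 := @expands_trans _ _ hT 1%g (2 * i - 1) i.
  rewrite wact1 in h2.
  rewrite (_ : 1 - i - 0%:Z = i - (2 * i - 1)); last by lia.
  apply: expands_step (T_type1_up hT _) h1 (h2 _) _; [by lia | by rewrite /=; lia |].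
  case=> [[l|[a b]]|]; rewrite /chain_coef /flat_coef ?sub0n; coef_cases.
move/up: IH => IH.
rewrite (_ : 1 - i - K.+1%:Z = i - (2 * i + K%:Z)); last by lia.
have h2 : expands T (T (trans (2 * (2 * i + K%:Z) - i, 2 * i - (2 * i + K%:Z) - 1)))
  (fun q => if q is Some (inr (c, d)) then
     if (c == 2 * i + K%:Z) && (d == i + K.+1%:Z) then 1 else 0 else 0).
  (* The second coordinate is - K - 1 < 0; s2 makes the translation dominant, with key (2i + K, i +
     K + 1). *)
  rewrite (_ : (_, _) = wact p2 (2 * (2 * i + K%:Z) - (i + K.+1%:Z),
     2 * (i + K.+1%:Z) - (2 * i + K%:Z) - 1)); first by apply: expands_trans => //=; lia.
  by rewrite wact_p2; congr pair => /=; lia.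
apply: expands_step (T_type1_up hT _) IH h2 _; first by lia.
case=> [[l|[a b]]|]; rewrite /chain_coef.
- by rewrite mulr0 addr0.
- by move: (_ - _)%N%:R => x; coef_cases.
- by rewrite mulr0 addr0.
Qed.

(** The ranges k <= 1 - i, k >= 2i and the stretch between give lengths 6i - 3 + 4K, 6i - 1 + 4K and
    at most 6i - 5, so the length decides the shape of the expansion. *)
Lemma expands_class_i (i : int) x : 1 <= i -> cc_set (class_i i) x ->
  [\/ exists k : int, [/\ i + 1 <= 2 * k, k <= 2 * i - 1,
        (ell x)%:Z = 2 * k + 2 * i - 3 & expands T (T x) (flat_coef i k)],
      exists K : nat, (ell x)%:Z = 6 * i - 3 + 4 * K%:Z /\
        expands T (T x) (chain_coef i K K)
    | exists K : nat, (ell x)%:Z = 6 * i - 1 + 4 * K%:Z /\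
        expands T (T x) (chain_coef i K.+1 K)].
Proof.
move=> i1 /(class_iP1 hT)[k [-> Ek]].
have [k_lo|k_lo] := lerP k (1 - i).
  constructor 2; exists (absz (1 - i - k)%R); split; first by ew_len.
  apply: (expands_eqc Ek).
  have [+ _] := expands_chain (absz (1 - i - k)%R) i1.
  by congr (expands T (T (type1 _ _)) _); lia.
have [k_hi|k_hi] := lerP (2 * i) k.
  constructor 3; exists (absz (k - 2 * i)%R); split; first by ew_len.
  apply: (expands_eqc Ek).
  have [_ +] := expands_chain (absz (k - 2 * i)%R) i1.
  by congr (expands T (T (type1 _ _)) _); lia.
constructor 1; have [k_mid|k_mid] := lerP (i + 1) (2 * k).
  exists k; split; [lia|lia|by ew_len|].
  by apply: (expands_eqc Ek); apply: (expands_flat hT); lia.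
exists (i + 1 - k); split; [lia|lia|by ew_len|].
by apply: (expands_eqc Ek); apply: (expands_type1_refl hT); lia.
Qed.
End Chain.

(** * Comparison of the coefficients with the tables *)

Lemma given_by_keys f g (R : conjclass -> laurent -> Prop) :
  (forall q, valid q -> f (key_class q) = g q) ->
  (forall O, (forall q, valid q -> O <> key_class q) -> f O = 0) ->
  (forall O y, R O y -> exists q, [/\ valid q, O = key_class q & g q = y]) ->
  (forall q, valid q -> g q = 0 \/ exists y, R (key_class q) y) ->
  given_by f R.
Proof.
move=> fg f0 R_sound R_complete; split=> [O y /R_sound[q [vq -> <-]]|O nR].
  exact: fg.
have [[q [vq OE]]|nO] := EM (exists q, valid q /\ O = key_class q); last first.
  by apply: f0 => q vq OE; apply: nO; exists q.
rewrite OE fg //; have [//|[y Ry]] := R_complete q vq.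
by case: (nR y); rewrite OE.
Qed.

Ltac flat_eval := rewrite /flat_coef; coef_cases.
Ltac chain_eval i M q n :=
  rewrite /chain_coef (_ : (M - depth i q)%N = n); [coef_cases | rewrite /depth; lia].

Lemma table1_sound (i len : nat) (k : int) O y :
  i%:Z + 1 <= 2 * k -> k <= 2 * i%:Z - 1 -> len%:Z = 2 * k + 2 * i%:Z - 3 ->
  table1 i len O y ->
  exists q, [/\ valid q, O = key_class q & flat_coef i%:Z k q = y].
Proof.
move=> k1 k2 len_k.
(* With the bottom at floor(i/2) + 1, half the excess length is k - floor(i/2) - 1, so the first
   index of E in the table is k itself. *)
have cl : class_length (class_i i%:Z) = ell (type1 i%:Z ((i%:Z %/ 2)%Z + 1)).
  by apply: class_i_length; lia.
case=> [l [a [a_bnd ->]]|]; last by exists (kI i%:Z); split=> //; flat_eval.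
move: a_bnd; rewrite {}cl /type1 ellE => a_bnd.
by exists (kL a i%:Z); split=> //=; [lia | flat_eval].
Qed.

Lemma table1_complete (i len : nat) (k : int) q :
  i%:Z + 1 <= 2 * k -> k <= 2 * i%:Z - 1 -> len%:Z = 2 * k + 2 * i%:Z - 3 ->
  valid q -> flat_coef i%:Z k q = 0 \/ exists y, table1 i len (key_class q) y.
Proof.
move=> k1 k2 len_k.
have cl : class_length (class_i i%:Z) = ell (type1 i%:Z ((i%:Z %/ 2)%Z + 1)).
  by apply: class_i_length; lia.
case: q => [[l|[a b]]|] vq; last by left.
  have [-> | ne] := eqVneq l i%:Z; first by right; exists 1; apply: Table1i.
  by left; rewrite /= (negPf ne).
rewrite /flat_coef; case: ifP => bnd; [right|by left].
exists lx; apply: Table1E; exists a; rewrite cl /type1 ellE.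
by split; [move: bnd; lia | congr (rt _ _); move: bnd; lia].
Qed.

Lemma table2_sound (i k : nat) O y : (0 < i)%N -> table2 i k O y ->
  exists q, [/\ valid q, O = key_class q & chain_coef i%:Z k k q = y].
Proof.
move=> i0; case.
- move=> j l jb [a [ab ->]]; exists (kL a j%:Z); split=> //=; first by lia.
  by chain_eval i%:Z k (kL a j%:Z) k.
- move=> l [a [ab ->]]; exists (kL a i%:Z); split=> //=; first by lia.
  by chain_eval i%:Z k (kL a i%:Z) k.
- move=> j l jb [a [ab ->]]; exists (kL a (i%:Z + j%:Z)); split=> //=; first by lia.
  by chain_eval i%:Z k (kL a (i%:Z + j%:Z)) (k - j)%N.
(* With a = 2i + j the depth is a - 2i + 1 = j + 1, hence the coefficient k - 1 - j. *)
- move=> j l jb [b [bb ->]]; exists (kL (2 * i%:Z + j%:Z) b); split=> //=; first by lia.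
  by chain_eval i%:Z k (kL (2 * i%:Z + j%:Z) b) (k - 1 - j)%N.
- move=> j jb; exists (kL (2 * i%:Z - 1 + j%:Z) (i%:Z + j%:Z)); split=> //=; first by lia.
  by chain_eval i%:Z k (kL (2 * i%:Z - 1 + j%:Z) (i%:Z + j%:Z)) (k - j)%N.
- move=> l lb; exists (kI l); split=> //=.
  by chain_eval i%:Z k (kI l) k.
- exists (kI i%:Z); split=> //=.
  by chain_eval i%:Z k (kI i%:Z) k.
- move=> j jb; exists (kI (2 - 2 * i%:Z - j%:Z)); split=> //=.
  by chain_eval i%:Z k (kI (2 - 2 * i%:Z - j%:Z)) (k - j)%N.
- move=> j jb; exists (kI (i%:Z + j%:Z)); split=> //=.
  by chain_eval i%:Z k (kI (i%:Z + j%:Z)) (k - j)%N.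
- by exists None; split=> //=; rewrite subn0.
- exists (kL (2 * i%:Z - 1) i%:Z); split=> //=; first by lia.
  by chain_eval i%:Z k (kL (2 * i%:Z - 1) i%:Z) k.
Qed.

Lemma table2_complete (i k : nat) q : (0 < i)%N -> valid q ->
  chain_coef i%:Z k k q = 0 \/ exists y, table2 i k (key_class q) y.
Proof.
move=> i0; case: q => [[l|[a b]]|] /= vq; last by right; eexists; apply: Table2id.
- case: (ltrgtP l i%:Z) => [l_lo|l_hi|->].
  + have [l_in|l_out] := lerP (2 - 2 * i%:Z) l.
      by right; eexists; apply: Table2l; lia.
    have [lk|kl] := lerP (2 - 2 * i%:Z - l) (k%:Z - 1).
      right; rewrite (_ : l = 2 - 2 * i%:Z - (absz (2 - 2 * i%:Z - l)%R)%:Z); last by lia.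
      by eexists; apply: Table2lo; lia.
    by left; rewrite (_ : (_ - _)%N = 0%N); [ring | lia].
  + have [lk|kl] := lerP (l - i%:Z) (k%:Z - 1).
      right; rewrite (_ : l = i%:Z + (absz (l - i%:Z)%R)%:Z); last by lia.
      by eexists; apply: Table2hi; lia.
    by left; rewrite (_ : (_ - _)%N = 0%N); [ring | lia].
  + by right; eexists; apply: Table2i.
(* A valid key failing this test has b = 2a or a + 1 = 2b, and there only (2i - 1, i) has a nonzero
   coefficient. *)
- case: (boolP ((b + 1 <= 2 * a) && (a + 2 <= 2 * b))) => ok; last first.
    case: ifP => lam; last by left; rewrite addr0.
    right; have [-> ->] : a = 2 * i%:Z - 1 /\ b = i%:Z by move: ok lam vq; lia.
    by eexists; apply: Table2lam0.
  (* The two bounds in [depth] agree on the line a = i + b - 1; to its left b governs the depth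
     (sets E), to its right a does (sets E'). On the line above b = i lie the translations counted
     by E in [chain_coef], so the entry for j = k keeps its x. *)
  case: (ltrgtP a (i%:Z + b - 1)) => a_pos.
  + case: (ltrgtP b i%:Z) => b_pos.
    * right; eexists; apply: (@Table2E _ _ (absz b)); first by lia.
      by exists a; split; [lia | congr (rt _ _); lia].
    * have [jk|jk] := lerP (b - i%:Z) (k%:Z - 1).
        right; eexists; apply: (@Table2Eij _ _ (absz (b - i%:Z)%R)); first by lia.
        by exists a; split; [lia | congr (rt _ _); lia].
      left; rewrite (_ : (_ - _)%N = 0%N); last by lia.
      by case: ifP => lam; [exfalso; move: lam; lia | ring].
    * right; eexists; apply: Table2Ei.
      by exists a; split; [lia | congr (rt _ _); lia].
  (* Here b <= a - i and a + 2 <= 2b force a >= 2i + 2, whence the lower bound 2 on j. *)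
  + have [jk|jk] := lerP (a - 2 * i%:Z) (k%:Z - 2).
      right; eexists; apply: (@Table2E' _ _ (absz (a - 2 * i%:Z)%R)); first by lia.
      by exists b; split; [lia | congr (rt _ _); lia].
    left; rewrite (_ : (_ - _)%N = 0%N); last by lia.
    by case: ifP => lam; [exfalso; move: lam; lia | ring].
  + have [jk|jk] := lerP (b - i%:Z) k%:Z.
      right; rewrite (_ : rt a b = rt (2 * i%:Z - 1 + (absz (b - i%:Z)%R)%:Z)
        (i%:Z + (absz (b - i%:Z)%R)%:Z)); last by congr (rt _ _); lia.
      by eexists; apply: Table2lam; lia.
    left; rewrite (_ : (_ - _)%N = 0%N); last by lia.
    by case: ifP => lam; [exfalso; move: lam; lia | ring].
Qed.

Lemma table3_sound (i k : nat) O y : (0 < i)%N -> table3 i k O y ->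
  exists q, [/\ valid q, O = key_class q & chain_coef i%:Z k.+1 k q = y].
Proof.
move=> i0; case.
- move=> j l jb [a [ab ->]]; exists (kL a j%:Z); split=> //=; first by lia.
  by chain_eval i%:Z k.+1 (kL a j%:Z) (k + 1)%N.
- move=> l [a [ab ->]]; exists (kL a i%:Z); split=> //=; first by lia.
  by chain_eval i%:Z k.+1 (kL a i%:Z) (k + 1)%N.
- move=> j l jb [a [ab ->]]; exists (kL a (i%:Z + j%:Z)); split=> //=; first by lia.
  by chain_eval i%:Z k.+1 (kL a (i%:Z + j%:Z)) (k + 1 - j)%N.
- move=> j l jb [b [bb ->]]; exists (kL (2 * i%:Z + j%:Z) b); split=> //=; first by lia.
  by chain_eval i%:Z k.+1 (kL (2 * i%:Z + j%:Z) b) (k - j)%N.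
- move=> j jb; exists (kL (2 * i%:Z - 1 + j%:Z) (i%:Z + j%:Z)); split=> //=; first by lia.
  by chain_eval i%:Z k.+1 (kL (2 * i%:Z - 1 + j%:Z) (i%:Z + j%:Z)) (k + 1 - j)%N.
- move=> l lb; exists (kI l); split=> //=.
  by chain_eval i%:Z k.+1 (kI l) (k + 1)%N.
- exists (kI i%:Z); split=> //=.
  by chain_eval i%:Z k.+1 (kI i%:Z) (k + 1)%N.
- move=> j jb; exists (kI (2 - 2 * i%:Z - j%:Z)); split=> //=.
  by chain_eval i%:Z k.+1 (kI (2 - 2 * i%:Z - j%:Z)) (k + 1 - j)%N.
- move=> j jb; exists (kI (i%:Z + j%:Z)); split=> //=.
  by chain_eval i%:Z k.+1 (kI (i%:Z + j%:Z)) (k + 1 - j)%N.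
- by exists None; split=> //=; rewrite subn0 addn1.
- exists (kL (2 * i%:Z - 1) i%:Z); split=> //=; first by lia.
  by chain_eval i%:Z k.+1 (kL (2 * i%:Z - 1) i%:Z) (k + 1)%N.
Qed.

(** The case split of [table2_complete] with M = k + 1: cut-offs due to the vanishing of M - depth
    move by one, while the range of [Table3lam], governed by E = k, stays. *)
Lemma table3_complete (i k : nat) q : (0 < i)%N -> valid q ->
  chain_coef i%:Z k.+1 k q = 0 \/ exists y, table3 i k (key_class q) y.
Proof.
move=> i0; case: q => [[l|[a b]]|] /= vq; last by right; eexists; apply: Table3id.
- case: (ltrgtP l i%:Z) => [l_lo|l_hi|->].
  + have [l_in|l_out] := lerP (2 - 2 * i%:Z) l.
      by right; eexists; apply: Table3l; lia.
    have [lk|kl] := lerP (2 - 2 * i%:Z - l) k%:Z.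
      right; rewrite (_ : l = 2 - 2 * i%:Z - (absz (2 - 2 * i%:Z - l)%R)%:Z); last by lia.
      by eexists; apply: Table3lo; lia.
    by left; rewrite (_ : (_ - _)%N = 0%N); [ring | lia].
  + have [lk|kl] := lerP (l - i%:Z) k%:Z.
      right; rewrite (_ : l = i%:Z + (absz (l - i%:Z)%R)%:Z); last by lia.
      by eexists; apply: Table3hi; lia.
    by left; rewrite (_ : (_ - _)%N = 0%N); [ring | lia].
  + by right; eexists; apply: Table3i.
- case: (boolP ((b + 1 <= 2 * a) && (a + 2 <= 2 * b))) => ok; last first.
    case: ifP => lam; last by left; rewrite addr0.
    right; have [-> ->] : a = 2 * i%:Z - 1 /\ b = i%:Z by move: ok lam vq; lia.
    by eexists; apply: Table3lam0.
  case: (ltrgtP a (i%:Z + b - 1)) => a_pos.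
  + case: (ltrgtP b i%:Z) => b_pos.
    * right; eexists; apply: (@Table3E _ _ (absz b)); first by lia.
      by exists a; split; [lia | congr (rt _ _); lia].
    * have [jk|jk] := lerP (b - i%:Z) k%:Z.
        right; eexists; apply: (@Table3Eij _ _ (absz (b - i%:Z)%R)); first by lia.
        by exists a; split; [lia | congr (rt _ _); lia].
      left; rewrite (_ : (_ - _)%N = 0%N); last by lia.
      by case: ifP => lam; [exfalso; move: lam; lia | ring].
    * right; eexists; apply: Table3Ei.
      by exists a; split; [lia | congr (rt _ _); lia].
  + have [jk|jk] := lerP (a - 2 * i%:Z) (k%:Z - 1).
      right; eexists; apply: (@Table3E' _ _ (absz (a - 2 * i%:Z)%R)); first by lia.
      by exists b; split; [lia | congr (rt _ _); lia].
    left; rewrite (_ : (_ - _)%N = 0%N); last by lia.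
    by case: ifP => lam; [exfalso; move: lam; lia | ring].
  + have [jk|jk] := lerP (b - i%:Z) k%:Z.
      right; rewrite (_ : rt a b = rt (2 * i%:Z - 1 + (absz (b - i%:Z)%R)%:Z)
        (i%:Z + (absz (b - i%:Z)%R)%:Z)); last by congr (rt _ _); lia.
      by eexists; apply: Table3lam; lia.
    left; rewrite (_ : (_ - _)%N = 0%N); last by lia.
    by case: ifP => lam; [exfalso; move: lam; lia | ring].
Qed.

Theorem proposition2p38 (H : algType laurent) (T : extW -> H)
    (hT : is_hecke_algebra T) (i : nat) (hi : (0 < i)%N) (w : extW)
    (hw : cc_set (class_i i%:Z) w)
    (f : {fsfun conjclass -> laurent with 0}) (hf : is_class_poly T w f) :
  [/\ (class_length (class_i i%:Z) <= length w <= 6 * i - 5)%N ->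
        given_by f (table1 i (length w)),
      forall k : nat, length w = (6 * i - 3 + 4 * k)%N ->
        given_by f (table2 i k)
    & forall k : nat, length w = (6 * i - 1 + 4 * k)%N ->
        given_by f (table3 i k)].
Proof.
have i1 : 1 <= i%:Z by lia.
rewrite lengthE.
(* Of the nine pairings of a shape with a clause, the six mismatched ones contradict the length, by
   size or modulo 4. *)
have [[k [k1 k2 len_w]]|[K [len_w]]|[K [len_w]]] := expands_class_i hT i1 hw;
  move=> /class_poly_expands /(_ hf) [fg f0]; split=> [len_w'|K' len_w'|K' len_w'];
  try by exfalso; lia.
- apply: given_by_keys fg f0 _ _ => [O y|q vq].
    exact: table1_sound.
  exact: table1_complete.
- rewrite (_ : K' = K); last by lia.
  apply: given_by_keys fg f0 _ _ => [O y|q vq].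
    exact: table2_sound.
  exact: table2_complete.
- rewrite (_ : K' = K); last by lia.
  apply: given_by_keys fg f0 _ _ => [O y|q vq].
    exact: table3_sound.
  exact: table3_complete.
Qed.
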